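(* Let $X$ be a finite space and $\Omega$ a canonical complex on $X$ with associated codimension function $\phi$. Then: (1) $\phi_x=\phi_y+1$ for any $x\prec y$; in particular $X$ is catenary. (2) For any $x<y$ in $X$, the interval $(x,y)$ is a homological sphere.
   Context: A finite space is a finite $T_0$ topological space (finite poset). Sheaves are of abelian groups; $D_c(X)$ (resp. $D^b_c(X)$) is the derived category of complexes with finitely generated (resp. and bounded) cohomology. A canonical complex on $X$ is $\Omega\in D^b_c(X)$ such that for every $F\in D_c(X)$ the natural map $F\to\mathbb R\mathcal{H}om^{\bullet}_X(\mathbb R\mathcal{H}om^{\bullet}_X(F,\Omega),\Omega)$ is an isomorphism; its associated codimension function is $x\mapsto\phi_x$ where $\phi_x$ is the unique integer with $\mathbb R\mathrm{Hom}^{\bullet}_X(\mathbb Z_{\{x\}},\Omega)\cong\mathbb Z[-\phi_x]$ ($\mathbb Z_{\{x\}}$ = constant sheaf supported at $x$). For $x<y$: $(x,y)=\{p:x<p<y\}$, $[x,y]=\{p:x\le p\le y\}$; $x\prec y$ means $x<y$ and $(x,y)=\emptyset$. $X$ is catenary if every interval $[x,y]$ is pure, i.e. all maximal chains from $x$ to $y$ have the same length. Dimension of a finite space is the maximal length of a chain (with $\dim\emptyset=-1$). The interval $(x,y)$ is a homological sphere if its reduced cohomology $H^i_{\mathrm{red}}((x,y),\mathbb Z)$ vanishes for $i\neq\dim(x,y)$ and is $\cong\mathbb Z$ for $i=\dim(x,y)$ (for the empty space, reduced cohomology is $\mathbb Z$ in degree $-1$). *)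

(* Defs.v *)
From HB Require Import structures.
From mathcomp Require Import all_boot all_order all_algebra.
From mathcomp Require Import boolp.

Set Implicit Arguments.
Unset Strict Implicit.
Unset Printing Implicit Defensive.

Import Order.TTheory GRing.Theory Num.Theory.
Local Open Scope ring_scope.
Local Open Scope quotient_scope.
Local Obligation Tactic := idtac.

Definition dprod (I : Type) (T : I -> zmodType) := forall i, T i.

Section DProd.
Variables (I : Type) (T : I -> zmodType).
Implicit Types f g h : dprod T.

HB.instance Definition _ := gen_eqMixin (dprod T).
HB.instance Definition _ := gen_choiceMixin (dprod T).

Lemma dprodP f g : (forall i, f i = g i) -> f = g.
Proof. exact: functional_extensionality_dep. Qed.

Definition dprod0 : dprod T := fun=> 0.
Definition dprodD f g : dprod T := fun i => f i + g i.
Definition dprodN f : dprod T := fun i => - f i.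

Fact dprodA : associative dprodD.
Proof. by move=> f g h; apply: dprodP => i; exact: addrA. Qed.
Fact dprodC : commutative dprodD.
Proof. by move=> f g; apply: dprodP => i; exact: addrC. Qed.
Fact dprod0D : left_id dprod0 dprodD.
Proof. by move=> f; apply: dprodP => i; exact: add0r. Qed.
Fact dprodND : left_inverse dprod0 dprodN dprodD.
Proof. by move=> f; apply: dprodP => i; exact: addNr. Qed.

HB.instance Definition _ :=
  GRing.isZmodule.Build (dprod T) dprodA dprodC dprod0D dprodND.
End DProd.

Definition zero_group : zmodType := 'I_1.

(* The identity of T i when i = j, and zero otherwise. *)
Definition transport (I : eqType) (T : I -> zmodType) (i j : I) (a : T i) : T j :=
  if i =P j is ReflectT e then ecast k (T k) e a else 0.
Arguments transport {I} T i j a.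

Lemma transport_id (I : eqType) (T : I -> zmodType) (i : I) (a : T i) :
  transport T i i a = a.
Proof. by rewrite /transport; case: eqP => // e; rewrite eq_axiomK. Qed.

Lemma transport_neq (I : eqType) (T : I -> zmodType) (i j : I) (a : T i) :
  i != j -> transport T i j a = 0.
Proof. by rewrite /transport; case: eqP. Qed.

Lemma transport_is_zmod_morphism (I : eqType) (T : I -> zmodType) (i j : I) :
  zmod_morphism (transport T i j).
Proof.
move=> a b; have [<-|ne] := eqVneq i j; first by rewrite !transport_id.
by rewrite !transport_neq // subr0.
Qed.
HB.instance Definition _ (I : eqType) (T : I -> zmodType) (i j : I) :=
  GRing.isZmodMorphism.Build _ _ (transport T i j)
    (@transport_is_zmod_morphism I T i j).

(* Differentials are given between any two degrees and vanish unless the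
   second is the successor of the first; this avoids casts between C (i + j)
   and C k when k = i + j holds only propositionally. *)
Record complex := Complex {
  cobj :> int -> zmodType;
  cdiff : forall i j, cobj i -> cobj j;
  cdiff_is_zmod_morphism : forall i j, zmod_morphism (@cdiff i j);
  cdiff_shape : forall i j a, j != i + 1 -> @cdiff i j a = 0;
  cdiffK : forall i j k a, @cdiff j k (@cdiff i j a) = 0 }.
Arguments cdiff C i j a : clear implicits, rename.

HB.instance Definition _ (C : complex) i j :=
  GRing.isZmodMorphism.Build _ _ (cdiff C i j)
    (@cdiff_is_zmod_morphism C i j).

Record complex_map (C D : complex) := ComplexMap {
  cmap :> forall n, C n -> D n;
  cmap_is_zmod_morphism : forall n, zmod_morphism (@cmap n);
  cmap_diff : forall i j a, cdiff D i j (@cmap i a) = @cmap j (cdiff C i j a) }.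

HB.instance Definition _ (C D : complex) (f : complex_map C D) n :=
  GRing.isZmodMorphism.Build _ _ (@cmap C D f n)
    (@cmap_is_zmod_morphism C D f n).

Section Cohomology.
Variables (C : complex) (n : int).

Definition is_cocycle : {pred C n} := fun z => cdiff C n (n + 1) z == 0.

Fact is_cocycle_zmod_closed : zmod_closed is_cocycle.
Proof.
split=> [|a b]; rewrite !unfold_in ?raddf0 // => /eqP za /eqP zb.
by rewrite raddfB /= za zb subr0.
Qed.
HB.instance Definition _ :=
  GRing.isZmodClosed.Build (C n) is_cocycle is_cocycle_zmod_closed.

Record cocycle := Cocycle
  { cocycle_val : C n; cocycleP : cocycle_val \in is_cocycle }.
HB.instance Definition _ := [isSub for cocycle_val].
HB.instance Definition _ := [Choice of cocycle by <:].
HB.instance Definition _ := [SubChoice_isSubZmodule of cocycle by <:].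

Definition is_coboundary : {pred cocycle} :=
  fun z => `[< exists b : C (n - 1), val z = cdiff C (n - 1) n b >].

Fact is_coboundary_zmod_closed : zmod_closed is_coboundary.
Proof.
split=> [|a b]; rewrite !unfold_in.
  by apply/asboolP; exists 0; rewrite !raddf0.
move=> /asboolP[u ua] /asboolP[v vb]; apply/asboolP; exists (u - v).
by rewrite !raddfB /= -ua -vb.
Qed.
HB.instance Definition _ :=
  GRing.isZmodClosed.Build cocycle is_coboundary is_coboundary_zmod_closed.

Definition cohomology : zmodType := Quotient.quot is_coboundary.
Definition cohomology_class (z : cocycle) : cohomology :=
  \pi_(Quotient.quot is_coboundary) z.
Definition cohomology_repr (h : cohomology) : cocycle :=
  repr (h : Quotient.quot is_coboundary).
End Cohomology.
Arguments is_cocycle C n _ : clear implicits.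

Definition zmod_iso (A B : zmodType) : Prop :=
  exists f : {additive A -> B}, bijective f.

Definition zmod_trivial (A : zmodType) : Prop := forall a : A, a = 0.

Definition zmod_fg (A : zmodType) : Prop :=
  exists k (g : 'I_k -> A), forall a, exists c : 'I_k -> int,
    a = \sum_(i < k) g i *~ c i.

Section CohomologyMap.
Variables (C D : complex) (f : complex_map C D) (n : int).

Fact cocycle_map_subproof (z : cocycle C n) : f n (val z) \in is_cocycle D n.
Proof.
have /eqP dz : val z \in is_cocycle C n := valP z.
by rewrite unfold_in cmap_diff dz raddf0.
Qed.
Definition cocycle_map (z : cocycle C n) : cocycle D n :=
  Cocycle (cocycle_map_subproof z).

Definition cohomology_map (h : cohomology C n) : cohomology D n :=
  cohomology_class (cocycle_map (cohomology_repr h)).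
End CohomologyMap.

Definition quasi_iso (C D : complex) (f : complex_map C D) : Prop :=
  forall n, bijective (@cohomology_map C D f n).

(* Isomorphism in the derived category: a roof whose legs are both
   quasi-isomorphisms. *)
Definition derived_iso (C D : complex) : Prop :=
  exists (E : complex) (f : complex_map E C) (g : complex_map E D),
    quasi_iso f /\ quasi_iso g.

(* A placed in degree n, i.e. A[-n]. *)
Section SingleComplex.
Variables (A : zmodType) (n : int).

Definition single_obj (i : int) : zmodType := if i == n then A else zero_group.

Fact single_is_zmod_morphism i j :
  zmod_morphism (fun _ : single_obj i => 0 : single_obj j).
Proof. by move=> a b; rewrite subr0. Qed.

Definition single_complex : complex :=
  @Complex single_obj (fun _ _ => fun=> 0) single_is_zmod_morphism
    (fun _ _ _ _ => erefl) (fun _ _ _ _ => erefl).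
End SingleComplex.

(* A finite T0 space is a finite poset X, the open sets being the up-sets and
   U_x = {y | x <= y} the least neighbourhood of x. A sheaf is given by its
   stalks F_x = F(U_x) and the restrictions F_x -> F_y for x <= y. The
   restriction from x to y is a total function, required to vanish when
   x <= y does not hold. *)
Record sheaf d (X : finPOrderType d) := Sheaf {
  stalk :> X -> zmodType;
  res : forall x y, stalk x -> stalk y;
  res_is_zmod_morphism : forall x y, zmod_morphism (@res x y);
  res_shape : forall x y a, ~~ (x <= y)%O -> @res x y a = 0;
  res_id : forall x a, @res x x a = a;
  res_comp : forall x y z a, (x <= y)%O -> (y <= z)%O ->
    @res y z (@res x y a) = @res x z a }.
Arguments res {d X} F x y a : rename.

HB.instance Definition _ d (X : finPOrderType d) (F : sheaf X) x y :=
  GRing.isZmodMorphism.Build _ _ (res F x y) (@res_is_zmod_morphism d X F x y).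

Record sheaf_map d (X : finPOrderType d) (F G : sheaf X) := SheafMap {
  smap :> forall x, F x -> G x;
  smap_is_zmod_morphism : forall x, zmod_morphism (@smap x);
  smap_res : forall x y a, res G x y (@smap x a) = @smap y (res F x y a) }.

HB.instance Definition _ d (X : finPOrderType d) (F G : sheaf X)
    (f : sheaf_map F G) x :=
  GRing.isZmodMorphism.Build _ _ (@smap d X F G f x)
    (@smap_is_zmod_morphism d X F G f x).

Definition injective_sheaf d (X : finPOrderType d) (J : sheaf X) : Prop :=
  forall (A B : sheaf X) (i : sheaf_map A B) (f : sheaf_map A J),
    (forall x, injective (i x)) ->
    exists g : sheaf_map B J, forall x a, g x (i x a) = f x a.

Section BasicSheaves.
Context {d} {X : finPOrderType d}.

Program Definition const_sheaf (A : zmodType) : sheaf X :=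
  @Sheaf d X (fun=> A) (fun x y a => if (x <= y)%O then a else 0) _ _ _ _.
Next Obligation. by move=> A x y a b; case: ifP; rewrite ?subr0. Qed.
Next Obligation. by move=> A x y a /negPf->. Qed.
Next Obligation. by move=> A x a; rewrite /= lexx. Qed.
Next Obligation. by move=> A x y z a xy yz; rewrite /= xy yz (le_trans xy yz). Qed.

Definition zero_sheaf : sheaf X := const_sheaf zero_group.

Definition point_stalk (x : X) (A : zmodType) (y : X) : zmodType :=
  if y == x then A else zero_group.

(* The sheaf A_{x}: stalk A at x, and zero stalks elsewhere. *)
Program Definition point_sheaf (x : X) (A : zmodType) : sheaf X :=
  @Sheaf d X (point_stalk x A) (transport (point_stalk x A)) _ _ _ _.
Next Obligation. by move=> x A y z; exact: transport_is_zmod_morphism. Qed.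
Next Obligation.
by move=> x A y z a nyz; rewrite transport_neq //; apply: contra nyz => /eqP->.
Qed.
Next Obligation. by move=> x A y a; exact: transport_id. Qed.
Next Obligation.
move=> x A y z w a yz zw; have [e|ne] := eqVneq y z.
  by case: z / e zw {yz} => _; rewrite transport_id.
rewrite (transport_neq _ ne) raddf0 transport_neq //.
by apply: contraNneq ne => e; rewrite eq_le yz e.
Qed.
End BasicSheaves.

Record sheaf_complex d (X : finPOrderType d) := SheafComplex {
  sobj :> int -> sheaf X;
  sdiff : forall i j, sheaf_map (sobj i) (sobj j);
  sdiff_shape : forall i j x a, j != i + 1 -> sdiff i j x a = 0;
  sdiffK : forall i j k x a, sdiff j k x (sdiff i j x a) = 0 }.
Arguments sdiff {d X} F i j : rename.

Record sheaf_complex_map d (X : finPOrderType d) (F G : sheaf_complex X) :=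
  SheafComplexMap {
  scmap :> forall n, sheaf_map (F n) (G n);
  scmap_diff : forall i j x a,
    sdiff G i j x (scmap i x a) = scmap j x (sdiff F i j x a) }.

Section SheafComplexes.
Context {d} {X : finPOrderType d}.
Implicit Types (F G I : sheaf_complex X) (x y : X) (n m : int).

Definition stalk_complex F x : complex :=
  @Complex (fun n => F n x) (fun i j => sdiff F i j x)
    (fun i j => @smap_is_zmod_morphism _ _ _ _ (sdiff F i j) x)
    (fun i j => @sdiff_shape _ _ F i j x) (fun i j k => @sdiffK _ _ F i j k x).

Definition stalk_complex_map F G (f : sheaf_complex_map F G) x :
    complex_map (stalk_complex F x) (stalk_complex G x) :=
  @ComplexMap (stalk_complex F x) (stalk_complex G x) (fun n => f n x)
    (fun n => @smap_is_zmod_morphism _ _ _ _ (f n) x)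
    (fun i j => @scmap_diff _ _ F G f i j x).

Definition sheaf_quasi_iso F G (f : sheaf_complex_map F G) : Prop :=
  forall x, quasi_iso (stalk_complex_map f x).

Program Definition zero_sheaf_map (A B : sheaf X) : sheaf_map A B :=
  @SheafMap d X A B (fun _ => fun=> 0) _ _.
Next Obligation. by move=> A B x a b; rewrite subr0. Qed.
Next Obligation. by move=> A B x y a; rewrite raddf0. Qed.

Definition single_sheaf (A : sheaf X) : sheaf_complex X :=
  @SheafComplex d X (fun n => if n == 0 then A else zero_sheaf)
    (fun i j => zero_sheaf_map _ _)
    (fun _ _ _ _ _ => erefl) (fun _ _ _ _ _ => erefl).

(* A sheaf on a finite space is finitely generated when its stalks are. *)
Definition fg_cohomology F : Prop :=
  forall n x, zmod_fg (cohomology (stalk_complex F x) n).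

Definition bounded_cohomology F : Prop :=
  exists a b : int, forall n x, n < a \/ b < n ->
    zmod_trivial (cohomology (stalk_complex F x) n).

Definition bounded_below F : Prop :=
  exists a : int, forall n x, n < a -> zmod_trivial (F n x).

Definition injective_resolution F I (s : sheaf_complex_map F I) : Prop :=
  [/\ bounded_below I, (forall n, injective_sheaf (I n)) & sheaf_quasi_iso s].

End SheafComplexes.

Section HomComplex.
Context {d} {X : finPOrderType d}.
Variables (U : {set X}) (F G : sheaf_complex X).
Implicit Types (n m p q : int) (x y z : X).

Definition hom_family :=
  dprod (fun p => dprod (fun q => dprod (fun x => dprod (fun a : F p x => G q x)))).

(* Degree n elements of Hom(F|_U, G|_U): families of morphisms
   F^p|_U -> G^(p+n)|_U, p ranging over the integers, encoded as families
   indexed by all p, q, x that vanish unless q = p + n and x \in U. *)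
Definition is_hom n : {pred hom_family} := fun f =>
  `[< [/\ forall p q x, zmod_morphism (f p q x),
          forall p q x a, (q != p + n) || (x \notin U) -> f p q x a = 0
        & forall p q x y a, x \in U -> y \in U -> (x <= y)%O ->
            res (G q) x y (f p q x a) = f p q y (res (F p) x y a)] >].

Fact is_hom_zmod_closed n : zmod_closed (is_hom n).
Proof.
split=> [|f g]; rewrite !unfold_in.
  apply/asboolP; split=> // [p q x a b|p q x y a _ _ _].
    by rewrite [RHS]subr0.
  exact: raddf0.
move=> /asboolP[f1 f2 f3] /asboolP[g1 g2 g3]; apply/asboolP.
have E p q x a : (f - g) p q x a = f p q x a - g p q x a by [].
split=> [p q x a b|p q x a h|p q x y a xU yU xy]; rewrite !E.
- by rewrite f1 g1 !opprD addrACA.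
- by rewrite f2 // g2 // subr0.
- by rewrite raddfB /= f3 // g3.
Qed.
HB.instance Definition _ n :=
  GRing.isZmodClosed.Build hom_family (is_hom n) (is_hom_zmod_closed n).

Record hom n := Hom { hom_val : hom_family; homP : hom_val \in is_hom n }.
HB.instance Definition _ n := [isSub for @hom_val n].
HB.instance Definition _ n := [Choice of hom n by <:].
HB.instance Definition _ n := [SubChoice_isSubZmodule of hom n by <:].

Definition hom_fun n (f : hom n) : forall p q x, F p x -> G q x := hom_val f.
Coercion hom_fun : hom >-> Funclass.
Arguments hom_fun {n} f p q x a.

Lemma hom_eqP n (f g : hom n) : (forall p q x a, f p q x a = g p q x a) -> f = g.
Proof.
move=> fg; apply: val_inj; apply: dprodP => p; apply: dprodP => q.
apply: dprodP => x; apply: dprodP => a.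
exact: fg.
Qed.

Lemma hom_additive n (f : hom n) p q x : zmod_morphism (f p q x).
Proof. by case: f => f /= /asboolP[]. Qed.
HB.instance Definition _ n (f : hom n) p q x :=
  GRing.isZmodMorphism.Build _ _ (hom_fun f p q x) (@hom_additive n f p q x).

Lemma hom_shape n (f : hom n) p q x a :
  (q != p + n) || (x \notin U) -> f p q x a = 0.
Proof. by case: f => f /= /asboolP[_ h _]; exact: h. Qed.

Lemma hom_res n (f : hom n) p q x y a : x \in U -> y \in U -> (x <= y)%O ->
  res (G q) x y (f p q x a) = f p q y (res (F p) x y a).
Proof. by case: f => f /= /asboolP[_ _ h]; exact: h. Qed.

(* df = d_G o f - (-1)^n f o d_F *)
Definition hom_diff_fun n m (f : hom n) : hom_family := fun p q x a =>
  if m == n + 1 then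
    sdiff G (q - 1) q x (f p (q - 1) x a)
    - f (p + 1) q x (sdiff F p (p + 1) x a) *~ (-1) ^ n
  else 0.

Fact hom_diff_subproof n m (f : hom n) : hom_diff_fun m f \in is_hom m.
Proof.
rewrite unfold_in; apply/asboolP; rewrite /hom_diff_fun.
have [->|_] := eqVneq m (n + 1); last first.
  by split=> // [p q x a b|p q x y a _ _ _]; rewrite ?subr0 ?raddf0.
split=> [p q x a b|p q x a h|p q x y a xU yU xy].
- by rewrite !raddfB /= mulrzBl !opprD addrACA.
- rewrite !hom_shape ?raddf0 ?mul0rz ?subr0 //.
    by case/orP: h => [h|->]; rewrite ?orbT // -addrA [1 + n]addrC h.
  case/orP: h => [h|->]; rewrite ?orbT // subr_eq -addrA h //.
- rewrite raddfB /= smap_res hom_res //; congr (_ - _).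
  by rewrite raddfMz /= hom_res // smap_res.
Qed.
Definition hom_diff n m (f : hom n) : hom m := Hom (hom_diff_subproof m f).

Fact hom_diff_is_zmod_morphism n m : zmod_morphism (@hom_diff n m).
Proof.
move=> f g; apply: hom_eqP => p q x a.
have E k (u v : hom k) p' q' x' a' :
  (u - v) p' q' x' a' = u p' q' x' a' - v p' q' x' a' by [].
rewrite E /= /hom_diff_fun; case: ifP => _; last by rewrite subr0.
by rewrite !E raddfB /= mulrzBl !opprD addrACA.
Qed.

Fact hom_diff_shape n m (f : hom n) : m != n + 1 -> hom_diff m f = 0.
Proof.
by move=> /negPf ne; apply: hom_eqP => p q x a /=; rewrite /hom_diff_fun ne.
Qed.

Fact hom_diffK n m k (f : hom n) : hom_diff k (hom_diff m f) = 0.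
Proof.
apply: hom_eqP => p q x a; rewrite /= /hom_diff_fun; case: ifP => // _.
have [e|ne] := eqVneq m (n + 1); last first.
  by rewrite !hom_diff_shape // raddf0 mul0rz subr0.
rewrite /= /hom_diff_fun e eqxx raddfB /= sdiffK sub0r raddfMz /=.
rewrite sdiffK raddf0 mul0rz subr0.
by rewrite exprzDr ?unitrN1 // expr1z mulrN1 mulrNz opprK addNr.
Qed.

Definition hom_complex : complex :=
  Complex hom_diff_is_zmod_morphism hom_diff_shape hom_diffK.
End HomComplex.
Arguments hom_fun {d X U F G n} f p q x a.
Arguments is_hom {d X} U F G n _.

Section SheafHom.
Context {d} {X : finPOrderType d}.
Variables (F G : sheaf_complex X).
Implicit Types (n m p q : int) (x y z : X).

Definition up_set x : {set X} := [set y | (x <= y)%O].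

Definition hom_restrict_fun n x y (f : hom (up_set x) F G n) : hom_family F G :=
  fun p q z a => if (x <= y)%O && (y <= z)%O then f p q z a else 0.

Fact hom_restrict_subproof n x y (f : hom (up_set x) F G n) :
  hom_restrict_fun y f \in is_hom (up_set y) F G n.
Proof.
rewrite unfold_in; apply/asboolP; rewrite /hom_restrict_fun.
have [xy|_] := boolP (x <= y)%O; last first.
  by split=> // [p q z a b|p q z w a _ _ _] /=; rewrite ?subr0 ?raddf0.
split=> [p q z a b|p q z a|p q z w a] /=.
- by case: ifP => _; rewrite ?subr0 // raddfB.
- rewrite inE; case: ifP => yz //= h; rewrite hom_shape //.
  by move: h; rewrite orbF => ->.
- rewrite !inE => yz yw zw; rewrite yz yw hom_res //.
    by rewrite inE (le_trans xy yz).
  by rewrite inE (le_trans xy yw).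
Qed.
Definition hom_restrict n x y (f : hom (up_set x) F G n) :
    hom (up_set y) F G n :=
  Hom (hom_restrict_subproof y f).

Lemma hom_restrictE n x y (f : hom (up_set x) F G n) p q z a :
  hom_restrict y f p q z a = if (x <= y)%O && (y <= z)%O then f p q z a else 0.
Proof. by []. Qed.

Fact hom_restrict_is_zmod_morphism n x y : zmod_morphism (@hom_restrict n x y).
Proof.
move=> f g; apply: hom_eqP => p q z a.
have E t (u v : hom (up_set t) F G n) : (u - v) p q z a = u p q z a - v p q z a
  by [].
by rewrite E !hom_restrictE E; case: ifP => _; rewrite ?subr0.
Qed.

(* The degree n component of the sheaf Hom complex: its stalk at x is the
   degree n part of Hom(F|_U_x, G|_U_x). *)
Program Definition sheaf_hom_obj n : sheaf X :=
  @Sheaf d X (fun x => hom (up_set x) F G n) (@hom_restrict n) _ _ _ _.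
Next Obligation. by move=> n x y; exact: hom_restrict_is_zmod_morphism. Qed.
Next Obligation.
move=> n x y f /negPf nxy; apply: hom_eqP => p q z a.
by rewrite hom_restrictE nxy.
Qed.
Next Obligation.
move=> n x f; apply: hom_eqP => p q z a; rewrite hom_restrictE lexx /=.
by case: ifP => // h; rewrite hom_shape // inE h orbT.
Qed.
Next Obligation.
move=> n x y z f xy yz; apply: hom_eqP => p q w a.
rewrite !hom_restrictE xy yz (le_trans xy yz) /=.
by case: ifP => // zw; rewrite (le_trans yz zw).
Qed.

Program Definition sheaf_hom_diff n m :
    sheaf_map (sheaf_hom_obj n) (sheaf_hom_obj m) :=
  @SheafMap d X _ _ (fun x => @hom_diff d X (up_set x) F G n m) _ _.
Next Obligation. by move=> n m x; exact: hom_diff_is_zmod_morphism. Qed.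
Next Obligation.
move=> n m x y f; apply: hom_eqP => p q z a.
rewrite /= /hom_restrict_fun /= /hom_diff_fun !hom_restrictE.
case: ifP => _; case: ifP => _ //; rewrite raddf0 mul0rz subr0 //.
Qed.

Program Definition sheaf_hom : sheaf_complex X :=
  @SheafComplex d X sheaf_hom_obj sheaf_hom_diff _ _.
Next Obligation. by move=> n m x f; exact: hom_diff_shape. Qed.
Next Obligation. by move=> n m k x f; exact: hom_diffK. Qed.
End SheafHom.

Section Biduality.
Context {d} {X : finPOrderType d}.
Variables (F I : sheaf_complex X).
Implicit Types (n m p q : int) (x y z : X).

(* The evaluation a |-> (phi |-> (-1)^(|a| |phi|) phi(a)). *)
Definition biduality_fun n x (a : F n x) : hom_family (sheaf_hom F I) I :=
  fun p q y (phi : hom (up_set y) F I p) =>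
    phi n q y (res (F n) x y a) *~ (-1) ^ (n * p).

Fact biduality_subproof n x (a : F n x) :
  biduality_fun a \in is_hom (up_set x) (sheaf_hom F I) I n.
Proof.
rewrite unfold_in; apply/asboolP; rewrite /biduality_fun.
split=> [p q y f g|p q y f|p q y z f].
- by rewrite -mulrzBl.
- rewrite inE => /orP[h|h]; last by rewrite res_shape // raddf0 mul0rz.
  by rewrite hom_shape ?mul0rz // addrC h.
- rewrite !inE => xy xz yz; rewrite raddfMz /= hom_res ?inE //.
  by rewrite res_comp // /hom_fun /= /hom_restrict_fun yz lexx.
Qed.
Definition biduality_stalk n x (a : F n x) :
    sheaf_hom (sheaf_hom F I) I n x :=
  Hom (biduality_subproof a).

Lemma biduality_stalkE n x (a : F n x) p q y (phi : hom (up_set y) F I p) :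
  hom_fun (biduality_stalk a) p q y phi =
  phi n q y (res (F n) x y a) *~ (-1) ^ (n * p).
Proof. by []. Qed.

Program Definition biduality_map n :
    sheaf_map (F n) (sheaf_hom (sheaf_hom F I) I n) :=
  @SheafMap d X _ _ (@biduality_stalk n) _ _.
Next Obligation.
move=> n x a b; apply: hom_eqP => p q y phi.
have E (u v : hom (up_set x) (sheaf_hom F I) I n) :
  (u - v) p q y phi = u p q y phi - v p q y phi by [].
by rewrite E !biduality_stalkE !raddfB /= mulrzBl.
Qed.
Next Obligation.
move=> n x y a; apply: hom_eqP => p q z phi.
rewrite hom_restrictE !biduality_stalkE.
have [xy|nxy] := boolP (x <= y)%O => /=; last first.
  by rewrite (res_shape _ nxy) !raddf0 mul0rz.
case: ifP => [yz|/negbT nyz]; first by rewrite res_comp.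
by rewrite res_shape // raddf0 mul0rz.
Qed.

Program Definition biduality :
    sheaf_complex_map F (sheaf_hom (sheaf_hom F I) I) :=
  @SheafComplexMap d X _ _ biduality_map _.
Next Obligation.
move=> n m x a; apply: hom_eqP => p q y phi.
rewrite /= /hom_diff_fun /= /biduality_fun; have [->|ne] := eqVneq m (n + 1); last first.
  by rewrite sdiff_shape // !raddf0 mul0rz.
rewrite /hom_fun /= /biduality_fun /= /hom_diff_fun eqxx /= smap_res raddfMz /=.
have sgn_sqr k : (-1) ^ k * (-1) ^ k = 1 :> int.
  by rewrite -exprzMl ?unitrN1 // mulrNN mulr1 exp1rz.
rewrite -mulrzA mulrDr mulr1 exprzDr ?unitrN1 // -mulrA sgn_sqr mulr1.
rewrite mulrzBl opprB addrC subrK -mulrzA.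
by rewrite mulrDl mul1r exprzDr ?unitrN1 // [in LHS]mulrC.
Qed.
End Biduality.

Section Canonical.
Context {d} {X : finPOrderType d}.

(* Derived functors RHom(-, Omega) are computed as Hom(-, I), where I is a
   bounded below complex of injectives quasi-isomorphic to Omega. *)
Definition canonical_complex (Omega : sheaf_complex X) : Prop :=
  [/\ fg_cohomology Omega, bounded_cohomology Omega
    & exists (I : sheaf_complex X) (s : sheaf_complex_map Omega I),
        injective_resolution s /\
        forall F : sheaf_complex X, fg_cohomology F ->
          sheaf_quasi_iso (biduality F I)].

Definition codimension_function (Omega : sheaf_complex X) (phi : X -> int) :
    Prop :=
  exists (I : sheaf_complex X) (s : sheaf_complex_map Omega I),
    injective_resolution s /\
    forall x : X,
      derived_iso (hom_complex [set: X] (single_sheaf (point_sheaf x int)) I)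
                  (single_complex int (phi x)).
End Canonical.

Section Sections.
Context {d} {X : finPOrderType d}.

Definition is_section (F : sheaf X) : {pred dprod F} := fun s =>
  `[< forall x y, (x <= y)%O -> res F x y (s x) = s y >].

Fact is_section_zmod_closed (F : sheaf X) : zmod_closed (@is_section F).
Proof.
split=> [|s t]; rewrite !unfold_in.
  by apply/asboolP => x y _; exact: raddf0.
move=> /asboolP hs /asboolP ht; apply/asboolP => x y xy.
rewrite -[(s - t) x]/(s x - t x) -[(s - t) y]/(s y - t y).
by rewrite raddfB /= hs // ht.
Qed.
HB.instance Definition _ (F : sheaf X) :=
  GRing.isZmodClosed.Build (dprod F) (@is_section F) (is_section_zmod_closed F).

Record sections (F : sheaf X) := Section_
  { section_val : dprod F; sectionP : section_val \in @is_section F }.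
HB.instance Definition _ F := [isSub for @section_val F].
HB.instance Definition _ F := [Choice of sections F by <:].
HB.instance Definition _ F := [SubChoice_isSubZmodule of sections F by <:].

Lemma sections_eqP (F : sheaf X) (s t : sections F) :
  (forall x, section_val s x = section_val t x) -> s = t.
Proof. by move=> st; apply: val_inj; exact: dprodP. Qed.

Fact sections_map_subproof (F G : sheaf X) (f : sheaf_map F G)
    (s : sections F) :
  ((fun x => f x (section_val s x)) : dprod G) \in @is_section G.
Proof.
rewrite unfold_in; apply/asboolP => x y xy; rewrite smap_res.
by case: s => s /= /asboolP ->.
Qed.
Definition sections_map (F G : sheaf X) (f : sheaf_map F G) (s : sections F) :
    sections G :=
  Section_ (sections_map_subproof f s).

Fact sections_map_is_zmod_morphism (F G : sheaf X) (f : sheaf_map F G) :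
  zmod_morphism (sections_map f).
Proof. by move=> s t; apply: sections_eqP => x /=; exact: raddfB. Qed.
HB.instance Definition _ (F G : sheaf X) (f : sheaf_map F G) :=
  GRing.isZmodMorphism.Build _ _ (sections_map f)
    (sections_map_is_zmod_morphism f).

Fact const_section_subproof (A : zmodType) (a : A) :
  ((fun=> a) : dprod (@const_sheaf d X A)) \in @is_section (const_sheaf A).
Proof. by rewrite unfold_in; apply/asboolP => x y /= ->. Qed.
Definition const_section (A : zmodType) (a : A) :
    sections (@const_sheaf d X A) :=
  Section_ (const_section_subproof a).

Fact const_section_is_zmod_morphism (A : zmodType) :
  zmod_morphism (@const_section A).
Proof. by move=> a b; apply: sections_eqP. Qed.
HB.instance Definition _ (A : zmodType) :=
  GRing.isZmodMorphism.Build _ _ (@const_section A)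
    (@const_section_is_zmod_morphism A).

Notation Zsheaf := (single_sheaf (const_sheaf int)).

Section ReducedComplex.
Variables (J : sheaf_complex X) (s : sheaf_complex_map Zsheaf J).
Implicit Types n m k : int.

Definition augmentation (a : int) : sections (J 0) :=
  sections_map (s 0) (const_section a).

Fact augmentation_is_zmod_morphism : zmod_morphism augmentation.
Proof. by move=> a b; rewrite /augmentation !raddfB. Qed.
HB.instance Definition _ :=
  GRing.isZmodMorphism.Build _ _ augmentation augmentation_is_zmod_morphism.

Let sec n : zmodType := sections (J n).
Let Zm1 : int -> zmodType := single_obj int (-1).

Definition reduced_obj n : zmodType := (Zm1 n * sec n)%type.

(* The section of J m is the differential of u.2, plus, for n = -1 and m = 0,
   the augmentation of u.1. *)
Definition reduced_diff n m (u : reduced_obj n) : reduced_obj m :=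
  (0, transport sec 0 m (augmentation (transport Zm1 n (-1) u.1))
      + sections_map (sdiff J n m) u.2).

Fact reduced_diff_is_zmod_morphism n m : zmod_morphism (@reduced_diff n m).
Proof.
move=> u v; apply: injective_projections; rewrite /= ?subr0 //.
by rewrite !raddfB /= opprD addrACA.
Qed.

Fact reduced_diff_shape n m u : m != n + 1 -> @reduced_diff n m u = 0.
Proof.
move=> ne; rewrite /reduced_diff; congr pair.
have -> : sections_map (sdiff J n m) u.2 = 0.
  by apply: sections_eqP => x; exact: sdiff_shape.
rewrite addr0; have [n1|n1] := eqVneq n (-1).
  by rewrite transport_neq //; apply: contra ne => /eqP <-; rewrite n1.
by rewrite (transport_neq _ n1) !raddf0.
Qed.

Fact reduced_diffK n m k u : @reduced_diff m k (@reduced_diff n m u) = 0.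
Proof.
rewrite /reduced_diff /= !raddf0 add0r raddfD /=; congr pair.
have -> v : sections_map (sdiff J m k) (sections_map (sdiff J n m) v) = 0.
  by apply: sections_eqP => x; exact: sdiffK.
rewrite addr0; have [<-|m0] := eqVneq 0 m; last first.
  by rewrite transport_neq // raddf0.
rewrite transport_id; apply: sections_eqP => x /=.
exact: etrans (@scmap_diff _ _ _ _ s 0 k x _) (raddf0 (s k x)).
Qed.

(* If J is a resolution of the constant sheaf Z this is the augmented complex
   Z -> Gamma(X, J), with Z in degree -1; it computes reduced cohomology. *)
Definition reduced_complex : complex :=
  Complex reduced_diff_is_zmod_morphism reduced_diff_shape reduced_diffK.
End ReducedComplex.
End Sections.

Section Chains.
Context {d} {X : finPOrderType d}.
Implicit Types (x y : X) (S C : {set X}).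

Definition chain C : bool := [forall x in C, forall y in C, (x >=< y)%O].

(* A chain with k elements has length k - 1. *)
Definition dimension : int := (\max_(C : {set X} | chain C) #|C|)%N%:Z - 1.

Definition maximal_chain S C : bool :=
  maxset (fun C' : {set X} => (C' \subset S) && chain C') C.

Definition closed_interval x y : {set X} := [set p | (x <= p <= y)%O].

Definition pure S : Prop :=
  forall C C', maximal_chain S C -> maximal_chain S C' -> #|C| = #|C'|.

Definition covered x y : Prop := (x < y)%O /\ forall p, ~~ (x < p < y)%O.
End Chains.
Arguments dimension {d} X.

Definition catenary d (X : finPOrderType d) : Prop :=
  forall x y : X, (x <= y)%O -> pure (closed_interval x y).

Definition open_interval d (X : finPOrderType d) (x y : X) :=
  {p : X | (x < p < y)%O}.

HB.instance Definition _ d (X : finPOrderType d) (x y : X) :=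
  Finite.on (open_interval x y).
HB.instance Definition _ d (X : finPOrderType d) (x y : X) :=
  SubFinite.on (open_interval x y).
HB.instance Definition _ d (X : finPOrderType d) (x y : X) :=
  [SubChoice_isSubPOrder of open_interval x y by <: with d].

Definition homological_sphere d (X : finPOrderType d) : Prop :=
  exists (J : sheaf_complex X)
    (s : sheaf_complex_map (single_sheaf (const_sheaf int)) J),
    injective_resolution s /\
    forall i, if i == dimension X
      then zmod_iso (cohomology (reduced_complex s) i) int
      else zmod_trivial (cohomology (reduced_complex s) i).

(* Main.v *)
(* Fix an injective resolution I of Omega.  For p in X and a set S of points,
   let Gamma_S(I)_p be the complex of those a in I_p whose restriction to every
   t >= p outside S vanishes; when S = {t <= q} it computes RHom(Z_[p,q], Omega),
   and when S = {t < q} it computes RHom(Z_[p,q), Omega).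
   By definition of phi, Gamma_{<= p}(I)_p has cohomology Z in degree phi p.
   Hence RHom(Z_{q}, Omega) is quasi-isomorphic to Z[-phi q] on the closure
   {x <= q} of q, and biduality for Z_{q}, read on the stalk at p < q, says that
   Gamma_{<= q}(I)_p is acyclic.  The exact sequence
   0 -> Gamma_{< q}(I)_p -> Gamma_{<= q}(I)_p -> Gamma_{<= q}(I)_q -> 0
   now shows that Gamma_{< q}(I)_p has cohomology Z in degree phi q + 1, generated
   by a class whose restrictions to all s in (p, q) are again generators.  If q
   covers p this is Gamma_{<= p}(I)_p, so phi p = phi q + 1.  In general
   s |-> Gamma_{< q}(I)_s, shifted by phi q + 1, is an injective resolution of Z on
   (p, q), and 0 -> Gamma_{<= p}(I)_p -> Gamma_{< q}(I)_p -> Gamma((p, q), -) -> 0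
   computes the reduced cohomology of (p, q). *)
From HB Require Import structures.
From mathcomp Require Import all_boot all_order all_algebra.
From mathcomp Require Import zify.
From mathcomp Require Import boolp.
Require Import Defs.
Set Implicit Arguments.
Unset Strict Implicit.
Unset Printing Implicit Defensive.
Import Order.TTheory GRing.Theory Num.Theory.
Local Open Scope ring_scope.

(** * Cohomology at the level of elements *)

(** [canonical_complex] and [codimension_function] each come with an injective resolution of their
    own, so the degree phi p has to be carried over to the resolution I for which biduality is
    known; resolutions are compared up to homotopy for this. The passage from the dual of Z_{q} to
    Z[-phi q] takes place inside Hom(-, I), hence rests on Hom(-, I) preserving quasi-isomorphisms.
    This is proved through the mapping cone: maps from an acyclic complex into a bounded below
    complex of injectives are null-homotopic. Both exact sequences are right exact because injective
    sheaves are flabby. A cohomology group Z is recorded by a generating cocycle. Isomorphisms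
    chosen point by point would not give a morphism from the constant sheaf Z to the complex on (p,
    q); one class over p that restricts to a generator everywhere does. The reduced cohomology of
    (p, q) sits in degree phi p - (phi q + 1) - 1: the shift accounts for phi q + 1, the connecting
    map for the last 1. That this is dim (p, q) uses part (1), since phi then counts the elements of
    maximal chains. *)

Record subgroup (A : zmodType) := Subgroup {
  sg_mem :> A -> Prop;
  sg_mem0 : sg_mem 0;
  sg_memB : forall a b, sg_mem a -> sg_mem b -> sg_mem (a - b) }.

Section SubgroupType.
Variables (A : zmodType) (S : subgroup A).

Definition sg_pred : {pred A} := fun a => `[< S a >].

Fact sg_pred_zmod_closed : zmod_closed sg_pred.
Proof.
split=> [|a b]; rewrite !unfold_in; first exact/asboolP/sg_mem0.
by move=> /asboolP ha /asboolP hb; apply/asboolP/sg_memB.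
Qed.
HB.instance Definition _ :=
  GRing.isZmodClosed.Build A sg_pred sg_pred_zmod_closed.

Record subgroup_elt := SubgroupElt { sg_val : A; sg_valP : sg_val \in sg_pred }.
HB.instance Definition _ := [isSub for sg_val].
HB.instance Definition _ := [Choice of subgroup_elt by <:].
HB.instance Definition _ := [SubChoice_isSubZmodule of subgroup_elt by <:].

Definition sg_type : zmodType := subgroup_elt.

Lemma sg_memP (a : sg_type) : S (sg_val a).
Proof. exact/asboolP/sg_valP. Qed.

Definition sg_elt (a : A) (h : S a) : sg_type := SubgroupElt (introT (asboolP _) h).

Lemma sg_inj (a b : sg_type) : sg_val a = sg_val b -> a = b.
Proof. exact: val_inj. Qed.

Lemma sg_valB (a b : sg_type) : sg_val (a - b) = sg_val a - sg_val b.
Proof. by []. Qed.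
Lemma sg_val0 : sg_val (0 : sg_type) = 0.
Proof. by []. Qed.
Lemma sg_valMz (a : sg_type) k : sg_val (a *~ k) = sg_val a *~ k.
Proof. exact: (raddfMz (val : sg_type -> A)). Qed.
End SubgroupType.

Section ComplexTheory.
Variable C : complex.
Implicit Types n m i j : int.

(* The two definitions below need no compatible choice of degrees, because
   cdiff C i j vanishes unless j = i + 1. *)
Definition cyc n (z : C n) := forall j, cdiff C n j z = 0.
Definition bnd n (z : C n) := exists i (b : C i), z = cdiff C i n b.
Definition exact_at n := forall z : C n, cyc z -> bnd z.

(** The class of [e] is a basis of a cohomology group isomorphic to Z. The cocycle itself is kept,
    because its images under restriction maps have to be followed. *)
Definition generates n (e : C n) :=
  [/\ cyc e, forall z, cyc z -> exists k : int, bnd (z - e *~ k)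
    & forall k : int, bnd (e *~ k) -> k = 0].

Definition sphere_like m :=
  (forall n, n != m -> exact_at n) /\ exists e : C m, generates e.

Lemma cyc_next n z : cdiff C n (n + 1) z = 0 -> cyc z.
Proof.
move=> dz j; have [->//|ne] := eqVneq j (n + 1); exact: cdiff_shape.
Qed.

Lemma bnd_from i n (z : C n) : n = i + 1 -> bnd z ->
  exists b : C i, z = cdiff C i n b.
Proof.
move=> ni [j [b ->]]; have [e|ne] := eqVneq j i; first by case: i / e ni; exists b.
(* The given preimage lies in a degree other than n - 1, so its differential is zero and 0 serves as
   well. *)
exists 0; rewrite raddf0 cdiff_shape //; apply: contra ne => /eqP.
by rewrite ni => /addIr ->.
Qed.

Lemma bnd0 n : bnd (0 : C n).
Proof. by exists n, 0; rewrite raddf0. Qed.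

Lemma bnd_diff i n (b : C i) : bnd (cdiff C i n b).
Proof. by exists i, b. Qed.

Lemma bndB n (z w : C n) : bnd z -> bnd w -> bnd (z - w).
Proof.
have nE : n = n - 1 + 1 by rewrite subrK.
move=> /(bnd_from nE)[a ->] /(bnd_from nE)[b ->].
by exists (n - 1), (a - b); rewrite raddfB.
Qed.

Lemma bndN n (z : C n) : bnd z -> bnd (- z).
Proof. by move=> h; rewrite -sub0r; apply: bndB h; exact: bnd0. Qed.

Lemma bndD n (z w : C n) : bnd z -> bnd w -> bnd (z + w).
Proof. by move=> hz /bndN hw; rewrite -[w]opprK; exact: bndB. Qed.

Lemma bndMz n (z : C n) k : bnd z -> bnd (z *~ k).
Proof. by case=> i [b ->]; exists i, (b *~ k); rewrite raddfMz. Qed.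

Lemma cycB n (z w : C n) : cyc z -> cyc w -> cyc (z - w).
Proof. by move=> hz hw j; rewrite raddfB /= hz hw subr0. Qed.

Lemma cycMz n (z : C n) k : cyc z -> cyc (z *~ k).
Proof. by move=> hz j; rewrite raddfMz /= hz mul0rz. Qed.

Lemma cyc0 n : cyc (0 : C n).
Proof. by move=> j; rewrite raddf0. Qed.

Lemma generatesP n (e e' : C n) :
  generates e -> cyc e' -> bnd (e - e') -> generates e'.
Proof.
case=> _ h1 h2 ce' he; split=> // [z /h1[k hk]|k hk].
  exists k; have -> : z - e' *~ k = (z - e *~ k) + (e - e') *~ k.
    by rewrite mulrzBl addrA subrK.
  exact: bndD hk (bndMz _ he).
by apply: h2; rewrite -[e](subrK e') mulrzDl; exact: bndD (bndMz _ he) hk.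
Qed.

(** If the degrees differed, exactness at m would make [e *~ 1] a boundary and force 1 = 0. This is
    how values of phi get compared. *)
Lemma sphere_like_uniq m m' : sphere_like m -> sphere_like m' -> m = m'.
Proof.
case=> h [e [ce _ ge]] [h' _]; apply/eqP; apply/negPn/negP => ne.
by have := ge 1 (h' _ ne _ (cycMz _ ce)).
Qed.

Lemma coboundaryP n (z : cocycle C n) : reflect (bnd (val z)) (z \in @is_coboundary C n).
Proof.
have nE : n = n - 1 + 1 by rewrite subrK.
apply: (iffP (asboolP _)) => [[b ->]|/(bnd_from nE)[b ->]]; last by exists b.
by exists (n - 1), b.
Qed.

Lemma class_eqP n (z w : cocycle C n) :
  cohomology_class z = cohomology_class w <-> bnd (val z - val w).
Proof.
transitivity (z - w \in @is_coboundary C n).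
  rewrite Quotient.idealrBE; exact: rwP eqP.
by split=> /(coboundaryP (z - w)).
Qed.

Lemma class_reprK n (h : cohomology C n) : cohomology_class (cohomology_repr h) = h.
Proof. exact: reprK. Qed.

Lemma cocycle_cyc n (z : cocycle C n) : cyc (val z).
Proof. by apply: cyc_next; apply/eqP; exact: (valP z). Qed.

Lemma cyc_cocycle n (z : C n) : cyc z -> exists z' : cocycle C n, val z' = z.
Proof.
move=> cz; have h : z \in is_cocycle C n by rewrite unfold_in; apply/eqP/cz.
by exists (Cocycle h).
Qed.

Lemma exact_cohomology n : exact_at n <-> zmod_trivial (cohomology C n).
Proof.
split=> h.
  move=> a; rewrite -(class_reprK a); set z := cohomology_repr a.
  rewrite -[0]class_reprK; apply/class_eqP; rewrite -raddfB.
  exact/h/cocycle_cyc.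
move=> z /cyc_cocycle[z' <-].
have := etrans (h (cohomology_class z')) (esym (h (cohomology_class 0))).
by move/class_eqP; rewrite /= subr0.
Qed.

Lemma generates_cohomology n : (exists e : C n, generates e) ->
  zmod_iso (cohomology C n) int.
Proof.
case=> e0 [/cyc_cocycle[e <-] gen free].
have classMz k : val (e *~ k) = val e *~ k by rewrite raddfMz.
have rep (a : cohomology C n) : exists k : int, a = cohomology_class (e *~ k).
  have [k hk] := gen _ (cocycle_cyc (cohomology_repr a)).
  by exists k; rewrite -[a]class_reprK; apply/class_eqP; rewrite classMz.
have uniq k l : cohomology_class (e *~ k) = cohomology_class (e *~ l) -> k = l.
  by move/class_eqP; rewrite !classMz -mulrzBr => /free/subr0_eq.
pose f a := projT1 (cid (rep a)).
have fP a : a = cohomology_class (e *~ f a) := projT2 (cid (rep a)).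
have fB : zmod_morphism f.
  move=> a b; apply: uniq; rewrite -fP mulrzBr {1}[a]fP {1}[b]fP.
  by rewrite /cohomology_class raddfB.
pose F := GRing.isZmodMorphism.Build _ _ f fB.
pose F' : {additive cohomology C n -> int} := HB.pack f F.
exists F'; exists (fun k => cohomology_class (e *~ k)) => [a|k] /=.
  by rewrite -fP.
by apply: uniq; rewrite -fP.
Qed.
End ComplexTheory.
Arguments exact_at C n : clear implicits.
Arguments sphere_like C m : clear implicits.

Section QuasiIso.
Variables (C D : complex) (f : complex_map C D).

Lemma cmap_cyc n (z : C n) : cyc z -> cyc (f n z).
Proof. by move=> h j; rewrite cmap_diff h raddf0. Qed.

Lemma cmap_bnd n (z : C n) : bnd z -> bnd (f n z).
Proof. by case=> i [b ->]; rewrite -cmap_diff; exact: bnd_diff. Qed.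

Lemma cohomology_map_class n (z : cocycle C n) :
  cohomology_map f (cohomology_class z) = cohomology_class (cocycle_map f z).
Proof.
apply/class_eqP => /=; rewrite -raddfB; apply: cmap_bnd.
by apply/class_eqP; rewrite class_reprK.
Qed.

(** Injectivity on cohomology in terms of cocycles; [bnd_covering] is surjectivity. *)
Definition bnd_reflecting := forall n (z : C n), cyc z -> bnd (f n z) -> bnd z.
Definition bnd_covering := forall n (w : D n), cyc w ->
  exists2 z : C n, cyc z & bnd (w - f n z).

Lemma quasi_isoP : quasi_iso f <-> bnd_reflecting /\ bnd_covering.
Proof.
split=> [qf|[refl cov] n].
  split=> n.
    move=> z0 /cyc_cocycle[z <-] hz; have [g fK _] := qf n.
    suff /class_eqP : cohomology_class z = cohomology_class 0.
      by rewrite /= subr0.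
    apply: (can_inj fK); rewrite !cohomology_map_class; apply/class_eqP => /=.
    by rewrite [f n 0]raddf0 subr0.
  move=> w0 /cyc_cocycle[w <-]; have [g _ gK] := qf n.
  pose z := cohomology_repr (g (cohomology_class w)).
  exists (val z); first exact: cocycle_cyc.
  suff /class_eqP : cohomology_class w = cohomology_class (cocycle_map f z) by [].
  by rewrite -cohomology_map_class class_reprK gK.
have inj : injective (@cohomology_map C D f n).
  move=> a b; rewrite -[a]class_reprK -[b]class_reprK !cohomology_map_class.
  move=> /class_eqP /= h; apply/class_eqP; apply: refl.
    by apply: cycB; exact: cocycle_cyc.
  by rewrite raddfB.
have surj b : exists a, @cohomology_map C D f n a = b.
  have [z0 /cyc_cocycle[z <-] hz] := cov n _ (cocycle_cyc (cohomology_repr b)).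
  exists (cohomology_class z); rewrite cohomology_map_class -[b]class_reprK.
  by apply/esym/class_eqP.
pose g b := projT1 (cid (surj b)).
have gK : cancel g (@cohomology_map C D f n) by move=> b; exact: projT2 (cid (surj b)).
by exists g => // a; apply: inj; rewrite gK.
Qed.

Hypothesis qf : quasi_iso f.

Lemma quasi_iso_bnd n (z : C n) : cyc z -> bnd (f n z) -> bnd z.
Proof. by case/quasi_isoP: qf => h _; exact: h. Qed.

Lemma quasi_iso_lift n (w : D n) : cyc w -> exists2 z : C n, cyc z & bnd (w - f n z).
Proof. by case/quasi_isoP: qf => _; exact. Qed.

Lemma quasi_iso_exact n : exact_at C n <-> exact_at D n.
Proof.
split=> h z cz; last first.
  exact/(quasi_iso_bnd cz)/h/cmap_cyc.
by have [w /h/cmap_bnd bw /bndD/(_ bw)] := quasi_iso_lift cz; rewrite subrK.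
Qed.

Lemma quasi_iso_generates n (e : C n) : cyc e -> generates e <-> generates (f n e).
Proof.
move=> ce; split=> -[_ gen free]; split=> //.
- exact: cmap_cyc.
- move=> w /quasi_iso_lift[z /gen[k bz] hw]; exists k.
  rewrite -(subrK (f n z) w) -addrA; apply: bndD hw _.
  by rewrite -raddfMz -raddfB; exact: cmap_bnd.
- by move=> k; rewrite -raddfMz => /quasi_iso_bnd - /(_ (cycMz _ ce)) /free.
- move=> z cz; have [k] := gen _ (cmap_cyc cz).
  rewrite -raddfMz -raddfB => /quasi_iso_bnd h; exists k; apply: h.
  exact: cycB cz (cycMz _ ce).
- by move=> k /cmap_bnd; rewrite raddfMz => /free.
Qed.

Lemma quasi_iso_sphere m : sphere_like C m <-> sphere_like D m.
Proof.
split=> -[h [e ge]]; split.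
- by move=> n /h/quasi_iso_exact.
- by have [ce _ _] := ge; exists (f m e); apply/quasi_iso_generates.
- by move=> n /h/quasi_iso_exact.
have [ce _ _] := ge; have [e' ce' he] := quasi_iso_lift ce.
exists e'; apply/(quasi_iso_generates ce'); exact: generatesP ge (cmap_cyc ce') he.
Qed.
End QuasiIso.

Lemma bijective_quasi_iso (C D : complex) (f : complex_map C D) :
  (forall n, injective (f n)) -> (forall n w, exists z, f n z = w) -> quasi_iso f.
Proof.
move=> inj surj; apply/quasi_isoP; split=> n.
  move=> z cz [i [b fz]]; have [a ab] := surj i b.
  by exists i, a; apply: inj; rewrite fz -ab cmap_diff.
move=> w cw; have [z zw] := surj n w; exists z.
  by move=> j; apply: inj; rewrite -cmap_diff zw cw raddf0.
by rewrite zw subrr; exact: bnd0.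
Qed.

(** The test for maps out of a copy of Z placed in a single degree; it serves for the dual of a
    point sheaf and for the unit from Z on an interval. *)
Lemma generator_quasi_iso (C D : complex) (f : complex_map C D) m (e : C m) :
  (forall z, exists k : int, z = e *~ k) ->
  (forall n, n != m -> zmod_trivial (C n)) ->
  (forall n, n != m -> exact_at D n) -> generates (f m e) -> quasi_iso f.
Proof.
move=> eg triv exD [_ gen free]; apply/quasi_isoP; split=> n.
  have [->|ne] := eqVneq n m; last by move=> z _ _; rewrite (triv _ ne z); exact: bnd0.
  move=> z _; have [k ->] := eg z; rewrite raddfMz => /free ->.
  by rewrite mulr0z; exact: bnd0.
have [->|ne] := eqVneq n m; last first.
  by move=> w /(exD _ ne) bw; exists 0; [exact: cyc0 | rewrite raddf0 subr0].
move=> w /gen[k bk]; exists (e *~ k); last by rewrite raddfMz.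
apply: cyc_next; apply: triv.
by rewrite -subr_eq0 addrAC subrr add0r oner_eq0.
Qed.

Lemma zero_group_eq0 : zmod_trivial zero_group.
Proof. by move=> a; exact: (ord1 (a : 'I_1)). Qed.

Lemma single_sphere m : sphere_like (single_complex int m) m.
Proof.
have z0 n : n != m -> zmod_trivial (single_complex int m n).
  move=> /negPf ne; by rewrite /= /single_obj ne => a; exact: zero_group_eq0.
split=> [n /z0 ne z _|]; first by rewrite (ne z); exact: bnd0.
have : exists e : single_complex int m m,
    (forall z, exists k : int, z = e *~ k) /\ (forall k : int, e *~ k = 0 -> k = 0).
  rewrite /= /single_obj eqxx; exists (1 : int).
  by split=> [z|k]; rewrite ?intz //; exists z; rewrite intz.
case=> e [gen free]; exists e; split=> // [z _|k [i [b]]]; last exact: free.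
by have [k ->] := gen z; exists k; rewrite subrr; exact: bnd0.
Qed.

Lemma derived_iso_sphere C m : derived_iso C (single_complex int m) -> sphere_like C m.
Proof.
case=> E [f [g [qf qg]]].
apply/(quasi_iso_sphere qf)/(quasi_iso_sphere qg); exact: single_sphere.
Qed.

(** * Exact sequences, shifts and augmentations *)

Lemma cdiffMz (C : complex) i j (a : C i) k : cdiff C i j (a *~ k) = cdiff C i j a *~ k.
Proof. exact: raddfMz. Qed.

Lemma cmapMz (C D : complex) (f : complex_map C D) n (a : C n) k :
  f n (a *~ k) = f n a *~ k.
Proof. exact: raddfMz. Qed.

Lemma cyc_succ (C : complex) n m (z : C n) : m = n + 1 -> cdiff C n m z = 0 -> cyc z.
Proof. by move=> ->; exact: cyc_next. Qed.

Section ShortExact.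
Variables (P R Q : complex) (i : complex_map P R) (r : complex_map R Q).
Hypothesis inj_i : forall n, injective (i n).
Hypothesis ri : forall n x, r n (i n x) = 0.
Hypothesis ker_r : forall n y, r n y = 0 -> exists x, y = i n x.
Hypothesis surj_r : forall n w, exists y, r n y = w.
Hypothesis exR : forall n, exact_at R n.

Section Connecting.
Variables (n n' : int).
Hypothesis nE : n' = n + 1.

(** The connecting map is handled as the relation [i z = d c] between cocycles z of P and elements c
    of R with r c a cocycle. These four facts say that, R being acyclic, the relation reaches every
    cocycle on either side and matches boundaries with boundaries. *)
Let lift_cyc (z : P n') : cyc z ->
  exists c : R n, [/\ i n' z = cdiff R n n' c & cyc (r n c)].
Proof.
move=> cz; have [c ic] := bnd_from nE (exR (cmap_cyc i cz)).
exists c; split=> //; apply: (cyc_succ nE).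
by rewrite cmap_diff -ic ri.
Qed.

Let bnd_lift (c : R n) (z : P n') : i n' z = cdiff R n n' c -> bnd (r n c) -> bnd z.
Proof.
move=> ic [j [w rc]]; have [w' rw] := surj_r w.
have [x hx] : exists x, c - cdiff R j n w' = i n x.
  by apply: ker_r; rewrite raddfB /= -cmap_diff rw rc subrr.
exists n, x; apply: inj_i; rewrite -cmap_diff -hx raddfB /= cdiffK subr0.
exact: ic.
Qed.

Let bnd_push (c : R n) (z : P n') : i n' z = cdiff R n n' c -> bnd z -> bnd (r n c).
Proof.
move=> ic /(bnd_from nE)[x zx].
have [j [b hb]] : bnd (c - i n x).
  apply: exR; apply: (cyc_succ nE); rewrite raddfB /= cmap_diff -ic zx subrr //.
have -> : r n c = cdiff Q j n (r j b).
  by rewrite cmap_diff -hb raddfB /= ri subr0.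
exact: bnd_diff.
Qed.

Let push_cyc (c : R n) : cyc (r n c) ->
  exists2 z : P n', i n' z = cdiff R n n' c & cyc z.
Proof.
move=> cc; have [z hz] : exists z, cdiff R n n' c = i n' z.
  by apply: ker_r; rewrite -cmap_diff cc.
by exists z => // j; apply: inj_i; rewrite -cmap_diff -hz cdiffK raddf0.
Qed.

Lemma connecting_exact : exact_at Q n <-> exact_at P n'.
Proof.
split=> ex z cz.
  by have [c [ic /ex/(bnd_lift ic)]] := lift_cyc cz.
have [c rc] := surj_r z; subst z.
by have [p ip /ex/(bnd_push ip)] := push_cyc cz.
Qed.

Lemma connecting_generates (c : R n) (p : P n') : i n' p = cdiff R n n' c ->
  generates (r n c) <-> generates p.
Proof.
move=> ip.
have ipB (c' : R n) (z : P n') k : i n' z = cdiff R n n' c' ->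
    i n' (z - p *~ k) = cdiff R n n' (c' - c *~ k).
  by move=> iz; rewrite !raddfB /= cmapMz cdiffMz ip iz.
have ipM k : i n' (p *~ k) = cdiff R n n' (c *~ k) by rewrite cmapMz cdiffMz ip.
split=> -[cg gen free]; split.
- by have [p' ip' cp'] := push_cyc cg; rewrite (inj_i (etrans ip (esym ip'))).
- move=> z /lift_cyc[c' [ic' /gen[k hk]]]; exists k.
  by apply: bnd_lift (ipB _ _ _ ic') _; rewrite raddfB /= cmapMz.
- by move=> k /(bnd_push (ipM k)); rewrite cmapMz => /free.
- by apply: (cyc_succ nE); rewrite cmap_diff -ip ri.
- move=> w cw; have [c' rc] := surj_r w; subst w.
  have [z iz /gen[k hk]] := push_cyc cw; exists k.
  by rewrite -cmapMz -raddfB; apply: bnd_push (ipB _ _ _ iz) hk.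
- by move=> k; rewrite -cmapMz => /(bnd_lift (ipM k)) /free.
Qed.
End Connecting.

Lemma connecting_sphere m m' : m' = m + 1 -> sphere_like Q m <-> sphere_like P m'.
Proof.
move=> mE; split=> -[ex [e ge]]; split.
- move=> n ne; apply/(connecting_exact (n := n - 1)); first by rewrite subrK.
  by apply: ex; rewrite subr_eq -mE.
- have [c rc] := surj_r e; subst e; have [cc _ _] := ge.
  have [p hp] : exists p, cdiff R m m' c = i m' p.
    by apply: ker_r; rewrite -cmap_diff cc.
  by exists p; apply/(connecting_generates mE (esym hp)).
- move=> n ne; apply/(connecting_exact (n' := n + 1) erefl); apply: ex.
  by rewrite mE (inj_eq (addIr _)).
have [ce _ _] := ge; have [c ic] := bnd_from mE (exR (cmap_cyc i ce)).
by exists (r m c); apply/(connecting_generates mE ic).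
Qed.
End ShortExact.

(* No sign is put on the differentials of the shift. *)
Section Shift.
Variables (C : complex) (c : int).

Fact shift_shape i j (a : C (i + c)) : j != i + 1 -> cdiff C (i + c) (j + c) a = 0.
Proof.
by move=> ne; apply: cdiff_shape; rewrite addrAC (inj_eq (addIr _)).
Qed.

Definition shift_complex : complex :=
  @Complex (fun n => C (n + c)) (fun i j => cdiff C (i + c) (j + c))
    (fun i j => @cdiff_is_zmod_morphism C (i + c) (j + c)) shift_shape
    (fun i j k => @cdiffK C (i + c) (j + c) (k + c)).

Lemma shift_cyc n (z : C (n + c)) : cyc (z : shift_complex n) <-> cyc z.
Proof.
split=> cz; last by move=> j; exact: cz.
by apply: (cyc_succ (m := n + 1 + c)); [rewrite addrAC | exact: cz].
Qed.

Lemma shift_bnd n (z : C (n + c)) : bnd (z : shift_complex n) <-> bnd z.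
Proof.
split=> [[i [b zb]]|bz]; first by exists (i + c), b.
have nE : n + c = n - 1 + c + 1 by rewrite addrAC subrK.
by have [b zb] := bnd_from nE bz; exists (n - 1), b.
Qed.

Lemma shift_exact n : exact_at shift_complex n <-> exact_at C (n + c).
Proof. by split=> h z /shift_cyc /h /shift_bnd. Qed.

Lemma shift_generates n (e : C (n + c)) : generates (e : shift_complex n) <-> generates e.
Proof.
split=> -[/shift_cyc ce gen free]; split=> //.
- by move=> z /shift_cyc/gen[k /shift_bnd bk]; exists k.
- by move=> k /shift_bnd/free.
- by move=> z /shift_cyc/gen[k /shift_bnd bk]; exists k.
- by move=> k /shift_bnd/free.
Qed.

Lemma shift_sphere m : sphere_like C m -> sphere_like shift_complex (m - c).
Proof.
case=> ex gen; split=> [n ne|].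
  by apply/shift_exact/ex; rewrite -(inj_eq (addIr (- c))) addrK.
(* The degrees m and m - c + c are only propositionally equal, so the whole existential is rewritten
   before a generator is taken from it. *)
have [e ge] : exists e : C (m - c + c), generates e by rewrite subrK.
by exists e; apply/shift_generates.
Qed.
End Shift.

Section Augmented.
Variables (C : complex) (e : C 0).
Hypothesis ce : cyc e.
Let Zm1 : int -> zmodType := single_obj int (-1).

(** The complex Z -> C sending 1 to [e], with Z in degree -1. It has the layout of
    [reduced_complex], so that restriction to an interval becomes a map between the two. *)
Definition aug_obj n : zmodType := (Zm1 n * C n)%type.

Definition aug_coef n (k : Zm1 n) : int := transport Zm1 n (-1) k.

Lemma aug_coef0 n : @aug_coef n 0 = 0.
Proof. exact: (raddf0 (transport Zm1 n (-1))). Qed.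

Lemma aug_coefB n k l : @aug_coef n (k - l) = aug_coef k - aug_coef l.
Proof. exact: (raddfB (transport Zm1 n (-1))). Qed.

Lemma aug_coef_neq n (k : Zm1 n) : n != -1 -> aug_coef k = 0.
Proof. exact: transport_neq. Qed.

Lemma aug_coef_id (k : int) : @aug_coef (-1) k = k.
Proof. exact: (@transport_id _ Zm1 (-1) k). Qed.

Definition aug_diff n m (u : aug_obj n) : aug_obj m :=
  (0, transport C 0 m (e *~ aug_coef u.1) + cdiff C n m u.2).

Fact aug_diff_is_zmod_morphism n m : zmod_morphism (@aug_diff n m).
Proof.
move=> u v; apply: injective_projections; rewrite /= ?subr0 //.
by rewrite aug_coefB mulrzBr !raddfB /= opprD addrACA.
Qed.

Fact aug_diff_shape n m u : m != n + 1 -> @aug_diff n m u = 0.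
Proof.
move=> ne; rewrite /aug_diff cdiff_shape // addr0; congr pair.
have [n1|n1] := eqVneq n (-1).
  by rewrite transport_neq //; apply: contra ne => /eqP <-; rewrite n1.
by rewrite aug_coef_neq // mulr0z raddf0.
Qed.

Fact aug_diffK n m k u : @aug_diff m k (@aug_diff n m u) = 0.
Proof.
rewrite /aug_diff /= aug_coef0 mulr0z raddf0 add0r raddfD /= cdiffK addr0.
congr pair; have [<-|m0] := eqVneq 0 m; last by rewrite transport_neq // raddf0.
by rewrite transport_id cdiffMz ce mul0rz.
Qed.

Definition aug_complex : complex :=
  Complex aug_diff_is_zmod_morphism aug_diff_shape aug_diffK.

Lemma aug_exact : (forall n, n != 0 -> exact_at C n) -> generates e ->
  forall n, exact_at aug_complex n.
Proof.
move=> ex [_ gen free] n [k z] ckz.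
have dkz m : transport C 0 m (e *~ aug_coef k) + cdiff C n m z = 0.
  by have /(congr1 snd) := ckz m.
have push i (b : C i) : cdiff aug_complex i n (0, b) = (0, cdiff C i n b).
  by rewrite /= /aug_diff aug_coef0 mulr0z raddf0 add0r.
(* A nonzero coefficient occurs only in degree -1; the cocycle condition then makes a nonzero
   multiple of [e] a boundary. *)
have [k0|kn0] := eqVneq (aug_coef k) 0; last first.
  have n1 : n = -1 by apply: contra_neq_eq kn0; exact: aug_coef_neq.
  subst n; case/eqP: kn0; apply: free.
  have := dkz 0; rewrite transport_id => /eqP; rewrite addr_eq0 => /eqP ->.
  exact/bndN/bnd_diff.
have cz : cyc z.
  by move=> m; have := dkz m; rewrite k0 mulr0z raddf0 add0r.
have k1 : k = 0.
  have [n1|n1] := eqVneq n (-1); last first.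
    by move: (k); rewrite /Zm1 /single_obj (negPf n1); exact: zero_group_eq0.
  by subst n; rewrite -[k]aug_coef_id.
subst k; have [n0|n0] := eqVneq n 0; last first.
  by have [i [b ->]] := ex _ n0 _ cz; exists i, (0, b); rewrite push.
subst n; have [l] := gen _ cz.
move=> /(bnd_from (i := -1))[|b zb]; first by [].
(* Here [z - e *~ l] is the differential of b, so the pair of l and b bounds the cocycle. *)
exists (-1), ((l : Zm1 (-1)), b); apply: injective_projections => //=.
by rewrite aug_coef_id transport_id -zb addrC subrK.
Qed.
End Augmented.

(** * Extension of morphisms into injective sheaves *)

Section SubSheaf.
Context {d} {X : finPOrderType d}.
Variables (F : sheaf X) (S : forall x, subgroup (F x)).
Hypothesis resS : forall x y a, S x a -> S y (res F x y a).

Definition subsheaf_res x y (a : sg_type (S x)) : sg_type (S y) :=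
  sg_elt (resS y (sg_memP a)).

Fact subsheaf_res_is_zmod_morphism x y : zmod_morphism (@subsheaf_res x y).
Proof. by move=> a b; apply: sg_inj; rewrite /= raddfB. Qed.

Fact subsheaf_res_shape x y (a : sg_type (S x)) : ~~ (x <= y)%O -> subsheaf_res y a = 0.
Proof. by move=> h; apply: sg_inj; rewrite /= res_shape. Qed.

Fact subsheaf_res_id x (a : sg_type (S x)) : subsheaf_res x a = a.
Proof. by apply: sg_inj; rewrite /= res_id. Qed.

Fact subsheaf_res_comp x y z (a : sg_type (S x)) : (x <= y)%O -> (y <= z)%O ->
  subsheaf_res z (subsheaf_res y a) = subsheaf_res z a.
Proof. by move=> xy yz; apply: sg_inj; rewrite /= res_comp. Qed.

Definition subsheaf : sheaf X :=
  Sheaf subsheaf_res_is_zmod_morphism subsheaf_res_shape subsheaf_res_id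
    subsheaf_res_comp.

Lemma sg_val_res x y (a : subsheaf x) : sg_val (res subsheaf x y a) = res F x y (sg_val a).
Proof. by []. Qed.
End SubSheaf.

Section Injective.
Context {d} {X : finPOrderType d}.
Variable J : sheaf X.
Hypothesis injJ : injective_sheaf J.

(* A morphism defined on a subsheaf of B is given by its graph R. *)
Lemma injective_extend (B : sheaf X) (R : forall x, B x -> J x -> Prop) :
  (forall x, R x 0 0) ->
  (forall x b c b' c', R x b c -> R x b' c' -> R x (b - b') (c - c')) ->
  (forall x c, R x 0 c -> c = 0) ->
  (forall x y b c, (x <= y)%O -> R x b c -> R y (res B x y b) (res J x y c)) ->
  exists g : sheaf_map B J, forall x b c, R x b c -> g x b = c.
Proof.
move=> R0 RB Rfun Rres.
have S0 x : exists c, R x 0 c by exists 0.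
have SB x b b' : (exists c, R x b c) -> (exists c, R x b' c) -> exists c, R x (b - b') c.
  by move=> [c h] [c' h']; exists (c - c'); exact: RB.
pose S x : subgroup (B x) := Subgroup (S0 x) (SB x).
have resS x y b : S x b -> S y (res B x y b).
  move=> [c h]; have [xy|nxy] := boolP (x <= y)%O; last first.
    by rewrite res_shape //; exists 0; exact: R0.
  by exists (res J x y c); exact: Rres.
pose f x (b : subsheaf resS x) : J x := projT1 (cid (sg_memP b)).
have fP x b : R x (sg_val b) (f x b) := projT2 (cid (sg_memP b)).
have uniq x b c c' : R x b c -> R x b c' -> c = c'.
  by move=> h h'; apply/subr0_eq/Rfun; rewrite -(subrr b); exact: RB.
have fB x : zmod_morphism (f x).
  by move=> a b; apply: (uniq x _ _ _ (fP x (a - b))); exact: RB (fP x a) (fP x b).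
have fres x y a : res J x y (f x a) = f y (res (subsheaf resS) x y a).
  have [xy|nxy] := boolP (x <= y)%O.
    exact: (uniq y _ _ _ (Rres x y _ _ xy (fP x a)) (fP y (res (subsheaf resS) x y a))).
  by rewrite !res_shape //; exact: (uniq y _ _ _ (R0 y) (fP y 0)).
have iB x : zmod_morphism (fun a : subsheaf resS x => sg_val a) by [].
have [|g gf] := injJ (A := subsheaf resS) (i := SheafMap iB (fun _ _ _ => erefl))
  (SheafMap fB fres); first by move=> x a b; exact: sg_inj.
exists g => x b c h; have Sb : S x b by exists c.
by have /= -> := gf x (sg_elt Sb); exact: (uniq x _ _ _ (fP x (sg_elt Sb)) h).
Qed.

(** Injectivity of the restriction of J to the open set U. Since U is an up-set, the extension by
    zero of B|_U is the subsheaf of B with zero stalks off U, and morphisms from it to J are the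
    morphisms from B|_U to J|_U. *)
Lemma injective_extend_on (U : {set X}) (B : sheaf X) (R : forall x, B x -> J x -> Prop) :
  (forall x y, x \in U -> (x <= y)%O -> y \in U) ->
  (forall x, R x 0 0) ->
  (forall x b c b' c', R x b c -> R x b' c' -> R x (b - b') (c - c')) ->
  (forall x c, x \in U -> R x 0 c -> c = 0) ->
  (forall x y b c, x \in U -> (x <= y)%O -> R x b c -> R y (res B x y b) (res J x y c)) ->
  exists g : forall x, B x -> J x,
  [/\ forall x, zmod_morphism (g x), forall x b, x \notin U -> g x b = 0,
      forall x y b, x \in U -> (x <= y)%O -> res J x y (g x b) = g y (res B x y b)
    & forall x b c, x \in U -> R x b c -> g x b = c].
Proof.
move=> upU R0 RB Rfun Rres.
have S0 x : x \in U \/ 0 = 0 :> B x by right.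
have SB x (b b' : B x) : x \in U \/ b = 0 -> x \in U \/ b' = 0 -> x \in U \/ b - b' = 0.
  by case=> [?|->]; [left | case=> [|->]; [left | right; rewrite subrr]].
pose S x := @Subgroup (B x) (fun b => x \in U \/ b = 0) (S0 x) (SB x).
have resS x y (b : B x) : S x b -> S y (res B x y b).
  case=> [xU|->]; last by right; rewrite raddf0.
  have [xy|nxy] := boolP (x <= y)%O; first by left; exact: upU xU xy.
  by right; rewrite res_shape.
pose R' x (b : subsheaf resS x) (c : J x) : Prop :=
  if x \in U then R x (sg_val b) c else c = 0.
have [||||g gR] := @injective_extend (subsheaf resS) R'; rewrite ?/R'.
- by move=> x; case: ifP.
- by move=> x b c b' c'; case: ifP => _; [exact: RB | move=> -> ->; rewrite subr0].
- by move=> x c; case: ifP => // xU; exact: Rfun.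
- move=> x y b c xy; case: ifP => [xU|xn ->]; first by rewrite (upU x y) //; exact: Rres.
  rewrite raddf0; case: ifP => // _.
  rewrite sg_val_res; case: (sg_memP b) => [xU|->]; last by rewrite raddf0.
  by move: (xU); rewrite xn.
pose emb x b : subsheaf resS x :=
  if pselect (x \in U) is left h then sg_elt (or_introl h : S x b) else 0.
have embE x b : sg_val (emb x b) = if x \in U then b else 0.
  by rewrite /emb; case: pselect => h /=; case: ifP => //; rewrite ?h // => /h.
exists (fun x b => g x (emb x b)); split.
- move=> x a b; rewrite -raddfB; congr (g x _); apply: sg_inj.
  by rewrite sg_valB !embE; case: ifP; rewrite ?subr0.
- move=> x b /negPf xn; rewrite -[RHS](raddf0 (g x)); congr (g x _).
  by apply: sg_inj; rewrite embE xn.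
- move=> x y b xU xy; rewrite smap_res; congr (g y _); apply: sg_inj.
  by rewrite sg_val_res !embE xU (upU x y).
- by move=> x b c xU Rbc; apply: gR; rewrite /R' xU embE xU.
Qed.

(** A section over the open set W is a morphism into J from the extension by zero of Z|_W, a
    subsheaf of the constant sheaf Z. Extend this morphism to Z and evaluate at 1. *)
Lemma flabby (W : {set X}) (s : forall x, J x) :
  (forall x y, x \in W -> (x <= y)%O -> y \in W /\ res J x y (s x) = s y) ->
  exists t : forall x, J x,
    (forall x y, (x <= y)%O -> res J x y (t x) = t y) /\
    (forall x, x \in W -> t x = s x).
Proof.
move=> hW; pose R x (b : @const_sheaf d X int x) (c : J x) : Prop :=
  if x \in W then c = s x *~ b else b = 0 /\ c = 0.
have [||||g gR] := @injective_extend (const_sheaf int) R; rewrite ?/R.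
- by move=> x; case: ifP.
- move=> x b c b' c'; case: ifP => _; first by move=> -> ->; rewrite mulrzBr.
  by move=> [-> ->] [-> ->]; rewrite !subr0.
- by move=> x c; case: ifP => _ [].
- move=> x y b c xy; case: ifP => [xW ->|_ [-> ->]].
    by have [-> <-] := hW _ _ xW xy; rewrite raddfMz /= xy.
  by rewrite !raddf0; case: ifP.
exists (fun x => g x (1 : int)); split=> [x y xy|x xW].
  by rewrite smap_res /= xy.
by apply: gR; rewrite /R xW.
Qed.
End Injective.

(** * Null homotopies *)

Lemma mulrz_sign_sign (A : zmodType) (a : A) (n : int) : a *~ (-1) ^ n *~ (-1) ^ n = a.
Proof. by rewrite -mulrzA -exprzMl ?unitrN1 // mulrNN mulr1 exp1rz. Qed.

Lemma dependent_sequence (T : Type) (P : nat -> T -> Prop) (R : nat -> T -> T -> Prop) :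
  (exists x, P 0%N x) -> (forall k x, P k x -> exists y, R k x y /\ P k.+1 y) ->
  exists u : nat -> T, (forall k, P k (u k)) /\ (forall k, R k (u k) (u k.+1)).
Proof.
move=> [x0 P0] step.
have step' k (x : {x | P k x}) : {y : {y | P k.+1 y} | R k (projT1 x) (projT1 y)}.
  have [y [Rxy Py]] := cid (step k _ (projT2 x)).
  by exists (exist _ y Py).
pose u := fix u k : {x | P k x} :=
  if k is k'.+1 then projT1 (step' k' (u k')) else exist _ x0 P0.
exists (fun k => projT1 (u k)); split=> k; first exact: projT2 (u k).
exact: projT2 (step' k (u k)).
Qed.

Section HomTheory.
Context {d} {X : finPOrderType d}.
Implicit Types (n m p q r : int) (x y z : X).

Lemma res_transport (G : sheaf_complex X) i j x y (a : G i x) :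
  res (G j) x y (transport (fun n => G n x) i j a)
  = transport (fun n => G n y) i j (res (G i) x y a).
Proof.
have [<-|ne] := eqVneq i j; first by rewrite !transport_id.
by rewrite !transport_neq // raddf0.
Qed.

Section Basic.
Variables (U : {set X}) (F G : sheaf_complex X).

Lemma homD n (f g : hom U F G n) p q x a : (f + g) p q x a = f p q x a + g p q x a.
Proof. by []. Qed.

Lemma homB n (f g : hom U F G n) p q x a : (f - g) p q x a = f p q x a - g p q x a.
Proof. by []. Qed.

Lemma hom_diffE n m (f : hom U F G n) p q r s x a : m = n + 1 -> q = r + 1 -> s = p + 1 ->
  hom_diff m f p q x a =
  sdiff G r q x (f p r x a) - f s q x (sdiff F p s x a) *~ (-1) ^ n.
Proof.
move=> mE qE ->; have -> : r = q - 1 by rewrite qE addrK.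
by rewrite /hom_fun /= /hom_diff_fun mE eqxx.
Qed.

Lemma hom_concentrated m P Q (g : forall x, F P x -> G Q x) :
  Q = P + m -> (forall x, zmod_morphism (g x)) ->
  (forall x a, x \notin U -> g x a = 0) ->
  (forall x y a, x \in U -> y \in U -> (x <= y)%O ->
    res (G Q) x y (g x a) = g y (res (F P) x y a)) ->
  exists h : hom U F G m, (forall x a, h P Q x a = g x a) /\
    (forall p q x a, p != P -> h p q x a = 0).
Proof.
move=> QE gB g0 gres.
pose h : hom_family F G := fun p q x a =>
  transport (fun n => G n x) Q q (g x (transport (fun n => F n x) p P a)).
have g00 x : g x 0 = 0 by rewrite -(subrr 0) gB subrr.
have hP : h \in is_hom U F G m.
  rewrite unfold_in; apply/asboolP; split=> [p q x a b|p q x a|p q x y a xU yU xy].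
  - by rewrite /h raddfB /= gB raddfB.
  - rewrite /h; case/orP => [ne|xU]; last by rewrite g0 // raddf0.
    have [Pp|Pp] := eqVneq p P; last by rewrite (transport_neq _ Pp) g00 raddf0.
    by rewrite transport_neq // eq_sym QE -Pp.
  - by rewrite /h res_transport gres // res_transport.
exists (Hom hP); split=> [x a|p q x a ne]; rewrite /hom_fun /= /h.
  by rewrite !transport_id.
by rewrite (transport_neq _ ne) g00 raddf0.
Qed.
End Basic.

Section NullHomotopy.
Variables (U : {set X}) (C J : sheaf_complex X) (a0 : int).
Hypothesis upU : forall x y, x \in U -> (x <= y)%O -> y \in U.
Hypothesis exC : forall x n, x \in U -> exact_at (stalk_complex C x) n.
Hypothesis lowJ : forall n x, n < a0 -> zmod_trivial (J n x).
Hypothesis injJ : forall n, injective_sheaf (J n).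

(** As f vanishes in degree P - 1, its component in degree P kills boundaries, which are all the
    cocycles. It therefore factors through d from degree P to P + 1, and injectivity extends the
    factor from the image of d. *)
Let null_step n (f : hom U C J n) (P : int) : hom_diff (n + 1) f = 0 ->
  (forall p q x a, p < P -> f p q x a = 0) ->
  exists h : hom U C J (n - 1),
    (forall p q x a, p != P + 1 -> h p q x a = 0) /\
    (forall p q x a, p <= P -> hom_diff n h p q x a = f p q x a).
Proof.
move=> df0 f0; pose Q : int := P + n; pose e : int := (-1) ^ (n - 1).
(* The graph of the factor on the image of d; the sign cancels the one that [hom_diff] puts on h d
   for h of degree n - 1. *)
pose R x (b : C (P + 1) x) (c : J Q x) :=
  exists a, b = sdiff C P (P + 1) x a /\ c = - (f P Q x a *~ e).
have [||||g [gB g0 gres gR]] := @injective_extend_on _ _ (J Q) (@injJ Q) U (C (P + 1)) R upU.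
- by move=> x; exists 0; rewrite !raddf0 mul0rz oppr0.
- move=> x b c b' c' [a [-> ->]] [a' [-> ->]]; exists (a - a').
  by rewrite !raddfB /= mulrzBl opprB opprK [- _ + _]addrC.
(* Well-definedness: da = 0 gives a = db, and the cocycle equation of f at b, where f b = 0, yields
   f a = 0. *)
- move=> x c xU [a [da ->]].
  have /(bnd_from (i := P - 1)) [|b ab] : bnd (a : stalk_complex C x P).
  + by apply: (@exC x P xU); exact: cyc_next.
  + by rewrite subrK.
  have := congr1 (fun h : hom U C J (n + 1) => h (P - 1) Q x b) df0.
  rewrite (@hom_diffE _ _ _ _ _ _ _ _ (Q - 1) P) ?subrK // f0; last by lia.
  rewrite raddf0 sub0r => /eqP; rewrite oppr_eq0 => /eqP fe.
  have -> : f P Q x a = 0.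
    by rewrite -[LHS](mulrz_sign_sign _ n) ab fe mul0rz.
  by rewrite mul0rz oppr0.
- move=> x y b c xU xy [a [-> ->]]; exists (res (C P) x y a); split.
    by rewrite smap_res.
  by rewrite raddfN raddfMz /= hom_res // (upU xU).
have QE : Q = P + 1 + (n - 1) by rewrite /Q; lia.
have [|h [hg h0]] := hom_concentrated (U := U) QE gB g0.
  by move=> x y a xU _ xy; exact: gres.
exists h; split=> // p q x a pP.
have [->|qE] := eqVneq q (p + n); last by rewrite !hom_shape ?qE.
have [xU|xU] := boolP (x \in U); last by rewrite !hom_shape ?xU ?orbT.
rewrite (@hom_diffE _ _ _ _ _ _ _ _ (p + n - 1) (p + 1)) ?subrK // h0; last by lia.
rewrite raddf0 sub0r; have [pE|pE] := eqVneq p P; last first.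
  by rewrite h0 ?f0 ?mul0rz ?oppr0 //; lia.
subst p; rewrite hg (gR _ _ (- (f P Q x a *~ e))) //; last by exists a.
by rewrite mulNrz opprK mulrz_sign_sign.
Qed.

(* The components of the homotopy are found one after the other, starting below
   the lower bound of J; each one is modified only once. *)
Lemma null_homotopic n (f : hom U C J n) : hom_diff (n + 1) f = 0 ->
  exists h : hom U C J (n - 1), hom_diff n h = f.
Proof.
(* For p < a0 - n the component of f in degree p lands below degree a0, where J is zero. *)
move=> df0; pose P0 : int := a0 - n.
pose inv k (h : hom U C J (n - 1)) :=
  forall p q x a, p < P0 + k%:Z -> (f - hom_diff n h) p q x a = 0.
pose R k (h h' : hom U C J (n - 1)) :=
  forall p q x a, p != P0 + k%:Z + 1 -> h' p q x a = h p q x a.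
have [||u [uP uR]] := @dependent_sequence _ inv R.
- exists 0 => p q x a pP; rewrite homB.
  have -> : hom_diff n (0 : hom U C J (n - 1)) = 0.
    exact: (raddf0 (cdiff (hom_complex U C J) _ _)).
  have [->|qE] := eqVneq q (p + n); last by rewrite !hom_shape ?qE ?subr0.
  by apply: lowJ; lia.
- move=> k h hP.
  have [|g [g0 gE]] := @null_step n (f - hom_diff n h) (P0 + k%:Z) _ hP.
    have /= -> := raddfB (cdiff (hom_complex U C J) n (n + 1)) f (hom_diff n h).
    by rewrite df0 hom_diffK subr0.
  exists (h + g); split=> p q x a pP; first by rewrite homD g0 ?addr0.
  have -> : hom_diff n (h + g) = hom_diff n h + hom_diff n g.
    exact: (raddfD (cdiff (hom_complex U C J) (n - 1) n)).
  by rewrite opprD addrA homB gE ?subrr //; lia.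
(* The step from [u k] to [u k.+1] changes only the component P0 + k + 1, so the component p is
   final from index p - P0 on, and constant throughout if p <= P0. *)
have stable p q x a K : (`|p - P0| <= K)%N -> u K p q x a = u `|p - P0|%N p q x a.
  elim: K => [|K IH] hK; first by have -> : `|p - P0|%N = 0%N by lia.
  have [<-//|ne] := eqVneq `|p - P0|%N K.+1.
  rewrite -IH; last by lia.
  by apply: uR; lia.
pose h : hom_family C J := fun p q x a => u `|p - P0|%N p q x a.
have hP : h \in is_hom U C J (n - 1).
  rewrite unfold_in; apply/asboolP; split=> [p q x|p q x a|p q x y a].
  - exact: hom_additive.
  - exact: hom_shape.
  - exact: hom_res.
exists (Hom hP); apply: hom_eqP => p q x a.
have [->|qE] := eqVneq q (p + n); last by rewrite !hom_shape ?qE.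
(* The successor puts p strictly below P0 + K, as the invariant demands; the second bound makes the
   component p + 1 final, since [hom_diff] involves it. *)
pose K := maxn `|(p - P0)%R|%N.+1 `|(p + 1 - P0)%R|%N.
have /eqP : (f - hom_diff n (u K)) p (p + n) x a = 0 by apply: uP; rewrite /K; lia.
rewrite homB subr_eq0 => /eqP ->.
rewrite !(@hom_diffE _ _ _ _ _ _ _ _ (p + n - 1) (p + 1)) ?subrK //.
by rewrite /hom_fun /= /h -!(@stable _ _ _ _ K) // /K; lia.
Qed.

Lemma hom_exact n : exact_at (hom_complex U C J) n.
Proof.
move=> f cf; have [h <-] := null_homotopic (cf (n + 1)).
by exists (n - 1), h.
Qed.
End NullHomotopy.
End HomTheory.
Arguments hom_diffE {d X U F G n m f p q} r s {x a}.

(** * Quasi-isomorphisms and complexes of morphisms *)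

Lemma zmod_morphismMz (A B : zmodType) (f : A -> B) a k :
  zmod_morphism f -> f (a *~ k) = f a *~ k.
Proof.
move=> fB; pose F : {additive A -> B} := HB.pack f (GRing.isZmodMorphism.Build _ _ f fB).
exact: (raddfMz F).
Qed.

Lemma homMz d (X : finPOrderType d) (U : {set X}) (F G : sheaf_complex X) n
    (f : hom U F G n) k p q x a : (f *~ k) p q x a = f p q x a *~ k.
Proof. exact: (@zmod_morphismMz _ _ (fun f : hom U F G n => f p q x a)). Qed.

Lemma smapN d (X : finPOrderType d) (F G : sheaf X) (f : sheaf_map F G) x a :
  f x (- a) = - f x a.
Proof. exact: raddfN. Qed.

Lemma smapMz d (X : finPOrderType d) (F G : sheaf X) (f : sheaf_map F G) x a k :
  f x (a *~ k) = f x a *~ k.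
Proof. exact: raddfMz. Qed.

Section Precomposition.
Context {d} {X : finPOrderType d}.
Implicit Types (n m p q r : int) (x y z : X).
Variables (U : {set X}) (A B J : sheaf_complex X) (u : sheaf_complex_map A B).

Definition precomp_fun n (g : hom U B J n) : hom_family A J :=
  fun p q x a => g p q x (u p x a).

Fact precomp_subproof n (g : hom U B J n) : precomp_fun g \in is_hom U A J n.
Proof.
rewrite unfold_in; apply/asboolP; split=> [p q x a b|p q x a|p q x y a xU yU xy].
- by rewrite /precomp_fun !raddfB.
- exact: hom_shape.
- by rewrite /precomp_fun hom_res // smap_res.
Qed.

Definition precomp n (g : hom U B J n) : hom U A J n := Hom (precomp_subproof g).

Fact precomp_is_zmod_morphism n : zmod_morphism (@precomp n).
Proof. by move=> f g; apply: hom_eqP. Qed.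

Fact precomp_diff n m (g : hom U B J n) : hom_diff m (precomp g) = precomp (hom_diff m g).
Proof.
apply: hom_eqP => p q x a; rewrite /hom_fun /= /precomp_fun /hom_fun /= /hom_diff_fun.
by case: ifP => // _; rewrite scmap_diff.
Qed.

Definition hom_precomp : complex_map (hom_complex U B J) (hom_complex U A J) :=
  @ComplexMap (hom_complex U B J) (hom_complex U A J) precomp
    precomp_is_zmod_morphism precomp_diff.
End Precomposition.

(** * The mapping cone *)

Section Cone.
Context {d} {X : finPOrderType d}.
Implicit Types (n m p q r : int) (x y z : X).
Variables (A B : sheaf_complex X) (u : sheaf_complex_map A B).

Definition cone_stalk n x : zmodType := (A (n + 1)%R x * B n x)%type.

Definition cone_res n x y (v : cone_stalk n x) : cone_stalk n y :=
  (res (A (n + 1)) x y v.1, res (B n) x y v.2).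

Fact cone_res_is_zmod_morphism n x y : zmod_morphism (@cone_res n x y).
Proof. by move=> v w; congr pair; rewrite raddfB. Qed.

Fact cone_res_shape n x y (v : cone_stalk n x) : ~~ (x <= y)%O -> cone_res y v = 0.
Proof. by move=> h; congr pair; rewrite res_shape. Qed.

Fact cone_res_id n x (v : cone_stalk n x) : cone_res x v = v.
Proof. by case: v => a b; congr pair; rewrite res_id. Qed.

Fact cone_res_comp n x y z (v : cone_stalk n x) : (x <= y)%O -> (y <= z)%O ->
  cone_res z (cone_res y v) = cone_res z v.
Proof. by move=> xy yz; congr pair; rewrite res_comp. Qed.

Definition cone_obj n : sheaf X :=
  Sheaf (@cone_res_is_zmod_morphism n) (@cone_res_shape n) (@cone_res_id n)
    (@cone_res_comp n).

Definition cone_diff_fun i j x (v : cone_stalk i x) : cone_stalk j x :=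
  (- sdiff A (i + 1) (j + 1) x v.1,
   transport (fun n => B n x) (i + 1) j (u (i + 1) x v.1) + sdiff B i j x v.2).

Fact cone_diff_is_zmod_morphism i j x : zmod_morphism (@cone_diff_fun i j x).
Proof.
move=> v w; congr pair; last by rewrite !raddfB /= opprD addrACA.
by rewrite -opprD -raddfB.
Qed.

Fact cone_diff_res i j x y (v : cone_stalk i x) :
  cone_res y (cone_diff_fun j v) = cone_diff_fun j (cone_res y v).
Proof.
by congr pair; rewrite ?raddfN ?raddfD /= ?res_transport !smap_res.
Qed.

Definition cone_diff i j : sheaf_map (cone_obj i) (cone_obj j) :=
  @SheafMap d X (cone_obj i) (cone_obj j) (@cone_diff_fun i j)
    (@cone_diff_is_zmod_morphism i j) (@cone_diff_res i j).

Fact cone_diff_shape i j x (v : cone_obj i x) : j != i + 1 -> cone_diff i j x v = 0.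
Proof.
move=> ne; congr pair; rewrite sdiff_shape ?oppr0 //.
  by rewrite (inj_eq (addIr _)).
by rewrite addr0 transport_neq // eq_sym.
Qed.

Fact cone_diffK i j k x (v : cone_obj i x) : cone_diff j k x (cone_diff i j x v) = 0.
Proof.
have [->|ji] := eqVneq j (i + 1); last by rewrite (cone_diff_shape _ ji) raddf0.
congr pair; first by rewrite /= smapN opprK sdiffK.
rewrite /= transport_id raddfD /= sdiffK addr0 scmap_diff !smapN raddfN /=.
have [->|ki] := eqVneq k (i + 1 + 1); first by rewrite transport_id addNr.
by rewrite transport_neq 1?eq_sym // sdiff_shape // !raddf0 addr0.
Qed.

Definition cone : sheaf_complex X := SheafComplex cone_diff_shape cone_diffK.

Lemma cone_diffE p s x a b : s = p + 1 ->
  sdiff cone p s x (a, b) =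
  (- sdiff A (p + 1) (s + 1) x a,
   transport (fun n => B n x) (p + 1) s (u (p + 1) x a) + sdiff B p s x b).
Proof. by []. Qed.

Fact cone_inr_is_zmod_morphism n x :
  zmod_morphism (fun b : B n x => (0, b) : cone n x).
Proof. by move=> b c; congr pair; rewrite subr0. Qed.

Fact cone_inr_res n x y (b : B n x) :
  res (cone n) x y (0, b) = (0, res (B n) x y b).
Proof. by congr pair; rewrite /= raddf0. Qed.

Fact cone_inr_diff i j x (b : B i x) :
  sdiff cone i j x (0, b) = (0, sdiff B i j x b).
Proof. by congr pair; rewrite /= !raddf0 ?oppr0 ?add0r. Qed.

Definition cone_inr : sheaf_complex_map B cone :=
  @SheafComplexMap d X B cone
    (fun n => @SheafMap d X (B n) (cone n) _ (@cone_inr_is_zmod_morphism n)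
       (@cone_inr_res n)) cone_inr_diff.

Lemma cone_exact x n : quasi_iso (stalk_complex_map u x) ->
  exact_at (stalk_complex cone x) n.
Proof.
(* With the degree written m + 1, a preimage has degree m and its first component lies in A (m + 1),
   without casts. *)
move=> qu; rewrite -(subrK 1 n); move: (n - 1) => m {n} [a b] cab.
have da j : sdiff A (m + 1 + 1) (j + 1) x a = 0.
  by apply/eqP; rewrite -oppr_eq0; have /(congr1 fst)/= -> := cab j.
have db j : transport (fun n => B n x) (m + 1 + 1) j (u (m + 1 + 1) x a) +
    sdiff B (m + 1) j x b = 0 by have /(congr1 snd) := cab j.
have cA : cyc (a : stalk_complex A x (m + 1 + 1)) by apply: cyc_next; exact: da.
have /(quasi_iso_bnd qu cA) : bnd (stalk_complex_map u x _ a).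
  have := db (m + 1 + 1); rewrite transport_id => /eqP; rewrite addr_eq0 => /eqP /= ->.
  exact/bndN/(@bnd_diff (stalk_complex B x)).
move=> /(bnd_from (i := m + 1)) [//|/= a' aE].
have cb : cyc (b + u (m + 1) x a' : stalk_complex B x (m + 1)).
  apply: cyc_next => /=; rewrite raddfD /= scmap_diff -aE.
  by have := db (m + 1 + 1); rewrite transport_id => h; apply: etrans h; exact: addrC.
have [z cz /(bnd_from (i := m)) [//|/= b' bE]] := quasi_iso_lift qu cb.
(* The differential is (d a' - d z, u z - u a' + d b'), where d z = 0 and d b' = b + u a' - u z. *)
exists m, (z - a', b'); congr pair; rewrite /=.
  by have /= h := cz (m + 1 + 1); rewrite raddfB /= h sub0r opprK.
rewrite transport_id -bE raddfB /=.
by rewrite [RHS]addrC addrA subrK addrK.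
Qed.
End Cone.

Section PrecompositionQuasiIso.
Context {d} {X : finPOrderType d}.
Implicit Types (n m p q r : int) (x y z : X).
Variables (U : {set X}) (A B J : sheaf_complex X) (u : sheaf_complex_map A B).
Hypothesis upU : forall x y, x \in U -> (x <= y)%O -> y \in U.
Hypothesis lowJ : bounded_below J.
Hypothesis injJ : forall n, injective_sheaf (J n).
Hypothesis qu : sheaf_quasi_iso u.

Local Notation K := (cone u).

Let hom_cone_exact n : exact_at (hom_complex U K J) n.
Proof.
have [a lowJa] := lowJ.
by apply: (hom_exact upU _ lowJa injJ) => x m _; exact: cone_exact.
Qed.

Let inl_fun n (h : hom U K J n) : hom_family A J :=
  fun p q x a => h (p - 1) q x (transport (fun i => A i x) p (p - 1 + 1) a, 0).

Let inl_subproof n (h : hom U K J n) : inl_fun h \in is_hom U A J (n - 1).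
Proof.
rewrite unfold_in; apply/asboolP; split=> [p q x a b|p q x a|p q x y a xU yU xy].
- by rewrite /inl_fun -raddfB; congr (h _ _ _ _); congr pair; rewrite ?raddfB ?subr0.
- by rewrite addrCA addrC => ?; exact: hom_shape.
- rewrite /inl_fun hom_res //; congr (h _ _ _ _); congr pair; rewrite ?raddf0 //=.
  by rewrite res_transport.
Qed.

Let inl n (h : hom U K J n) : hom U A J (n - 1) := Hom (inl_subproof h).

Let inlE n (h : hom U K J n) p p' q x a : p = p' + 1 ->
  inl h p q x a = h p' q x (transport (fun i => A i x) p (p' + 1) a, 0).
Proof. by move=> pE; have -> : p' = p - 1 by rewrite pE addrK. Qed.

(** With this sign the sum is a cocycle as soon as g is one and g u = dk. *)
Let sum_fun n (k : hom U A J (n - 1)) (g : hom U B J n) : hom_family K J :=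
  fun p q x v => k (p + 1) q x v.1 *~ (-1) ^ n + g p q x v.2.

Let sum_subproof n (k : hom U A J (n - 1)) (g : hom U B J n) :
  sum_fun k g \in is_hom U K J n.
Proof.
rewrite unfold_in; apply/asboolP; split=> [p q x a b|p q x a h|p q x y a xU yU xy].
- by rewrite /sum_fun !raddfB /= mulrzBl opprD addrACA.
- rewrite /sum_fun !hom_shape ?mul0rz ?addr0 //.
  by have -> : p + 1 + (n - 1) = p + n by lia.
- by rewrite /sum_fun raddfD raddfMz /= !hom_res.
Qed.

Let sum n (k : hom U A J (n - 1)) (g : hom U B J n) : hom U K J n := Hom (sum_subproof k g).

(* A morphism from the cone of u into J is a morphism g from B into J together
   with a homotopy from g u to zero, up to signs. *)
Lemma precomp_quasi_iso : quasi_iso (hom_precomp U J u).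
Proof.
have signP n : (-1) ^ (n - 1) = - (-1) ^ n :> int.
  by rewrite exprzDr ?unitrN1 // mulrN1.
have signS n : (-1) ^ (n + 1) = - (-1) ^ n :> int.
  by rewrite exprzDr ?unitrN1 // expr1z mulrN1.
apply/quasi_isoP; split=> n.
  (* Injectivity: if g u = dk, then k and g form a cocycle on the cone, hence a boundary;
     restricting it to B shows that g is one. *)
  move=> g cg /(bnd_from (i := n - 1)) [|k gk]; first by rewrite subrK.
  have : bnd (sum k g : hom_complex U K J n).
    apply: hom_cone_exact; apply: cyc_next.
    rewrite -[cdiff _ _ _ _]/(hom_diff (n + 1) (sum k g)).
    apply: hom_eqP => p q x [a b].
    have [->|qE] := eqVneq q (p + (n + 1)); last by rewrite !hom_shape ?qE.
    have qE : p + (n + 1) = p + n + 1 by rewrite addrA.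
    have dg : hom_diff (n + 1) g p (p + (n + 1)) x b = 0.
      exact: (congr1 (fun h : hom U B J (n + 1) => h _ _ _ _) (cg (n + 1))).
    have dk : hom_diff n k (p + 1) (p + (n + 1)) x a = g (p + 1) (p + (n + 1)) x (u (p + 1) x a).
      exact: (congr1 (fun h : hom U A J n => h _ _ _ _) (esym gk)).
    move: dg dk; rewrite (hom_diffE (p + n) (p + 1)) //.
    rewrite (hom_diffE (p + n) (p + 1 + 1)) ?subrK //.
    rewrite (hom_diffE (p + n) (p + 1)) // cone_diffE // transport_id.
    have homN m (h : hom U A J m) i j y c : h i j y (- c) = - h i j y c by exact: raddfN.
    have sumE i j y v : sum k g i j y v = k (i + 1) j y v.1 *~ (-1) ^ n + g i j y v.2 by [].
    rewrite !sumE /= homN mulNrz mulrzDl mulNrz mulrz_sign_sign !raddfD /= smapMz.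
    rewrite signP mulrNz opprK => /subr0_eq -> <-.
    rewrite !mulrzDl mulrz_sign_sign !addrA opprK.
    by rewrite -[X in X - _]addrA [X in _ + X - _]addrC addrA subrr.
  case=> i [h gh]; have := cmap_bnd (hom_precomp U J (cone_inr u)) (bnd_diff n h).
  rewrite -gh => {gh} [gb]; suff -> : g = hom_precomp U J (cone_inr u) n (sum k g) by [].
  apply: hom_eqP => p q x b.
  by rewrite /hom_fun /= /precomp_fun /hom_fun /= /sum_fun raddf0 mul0rz add0r.
move=> f cf.
(* Surjectivity: f composed with the projection of the cone to A is a cocycle of degree n + 1, hence
   some dh. The B-component of h gives the class sought, its A-component the homotopy. *)
pose e_fun : hom_family K J := fun p q x v => f (p + 1) q x v.1.
have eP : e_fun \in is_hom U K J (n + 1).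
  rewrite unfold_in; apply/asboolP; split=> [p q x v w|p q x v qE|p q x y v xU yU xy].
  - by rewrite /e_fun raddfB.
  - by apply: hom_shape; rewrite -addrA [1 + n]addrC.
  - by rewrite /e_fun hom_res.
pose e : hom U K J (n + 1) := Hom eP.
have eE p q x v : e p q x v = f (p + 1) q x v.1 by [].
have df p q x a : hom_diff (n + 1) f p q x a = 0.
  exact: (congr1 (fun h : hom U A J (n + 1) => h p q x a) (cf (n + 1))).
have homN m (h : hom U K J m) i j y c : h i j y (- c) = - h i j y c by exact: raddfN.
have /hom_cone_exact/(bnd_from (i := n))[//|h he] : cyc (e : hom_complex U K J (n + 1)).
  apply: cyc_next; rewrite -[cdiff _ _ _ _]/(hom_diff (n + 1 + 1) e).
  apply: hom_eqP => p q x [a b].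
  have [->|qE] := eqVneq q (p + (n + 1 + 1)); last by rewrite !hom_shape ?qE.
  have qE : p + (n + 1 + 1) = p + (n + 1) + 1 by rewrite addrA.
  rewrite (hom_diffE (p + (n + 1)) (p + 1)) // !eE cone_diffE //=.
  have := df (p + 1) (p + (n + 1 + 1)) x a.
  rewrite (hom_diffE (p + (n + 1)) (p + 1 + 1)) // => df0.
  have -> : f (p + 1 + 1) (p + (n + 1 + 1)) x (- sdiff A (p + 1) (p + 1 + 1) x a) =
     - f (p + 1 + 1) (p + (n + 1 + 1)) x (sdiff A (p + 1) (p + 1 + 1) x a) by exact: raddfN.
  by rewrite signS mulrNz mulNrz opprK.
pose g : hom_complex U B J n := hom_precomp U J (cone_inr u) n h.
(* The equation e = dh evaluated at (a, 0) reads f = d(inl h) - (-1)^n g u. *)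
exists (g *~ - (-1) ^ n).
  apply: cycMz; apply: cyc_next; rewrite cmap_diff -he.
  by apply: hom_eqP => p q x b; exact: (raddf0 (hom_fun f (p + 1) q x)).
exists (n - 1), (inl h); rewrite cmapMz.
rewrite -[cdiff _ _ _ _]/(hom_diff n (inl h)); apply: hom_eqP => p q x.
rewrite -(subrK 1 p); move: (p - 1) => {}p a.
have [->|qE] := eqVneq q (p + 1 + n); last by rewrite !hom_shape ?qE.
have qE : p + 1 + n = p + n + 1 by rewrite addrAC.
have fE : f (p + 1) (p + 1 + n) x a = hom_diff (n + 1) h p (p + 1 + n) x (a, 0).
  exact: (congr1 (fun e : hom U K J (n + 1) => e p (p + 1 + n) x (a, 0)) he).
rewrite homB homMz fE (hom_diffE (p + n) (p + 1)) //.
rewrite (hom_diffE (p + n) (p + 1 + 1)) ?subrK //.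
rewrite !(inlE _ _ _ erefl) !transport_id.
rewrite -[hom_precomp U J u n g (p + 1) _ x a]/(h (p + 1) (p + 1 + n) x (0, u (p + 1) x a)).
have -> : sdiff K p (p + 1) x (a, 0) =
    (0, u (p + 1) x a) - (sdiff A (p + 1) (p + 1 + 1) x a, 0).
  by rewrite cone_diffE // transport_id; congr pair; rewrite /= ?sub0r // raddf0 addr0 subr0.
by rewrite raddfB /= signP !mulrNz !opprK mulrzBl opprB addrA subrK.
Qed.
End PrecompositionQuasiIso.

(** * Sections with supports *)

Section Subcomplex.
Variables (C : complex) (S : forall n, subgroup (C n)).
Hypothesis diffS : forall i j a, S i a -> S j (cdiff C i j a).

Definition subcomplex_diff i j (a : sg_type (S i)) : sg_type (S j) :=
  sg_elt (diffS j (sg_memP a)).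

Fact subcomplex_diff_is_zmod_morphism i j : zmod_morphism (@subcomplex_diff i j).
Proof. by move=> a b; apply: sg_inj; rewrite /= raddfB. Qed.

Fact subcomplex_diff_shape i j (a : sg_type (S i)) : j != i + 1 -> subcomplex_diff j a = 0.
Proof. by move=> ne; apply: sg_inj; rewrite /= cdiff_shape. Qed.

Fact subcomplex_diffK i j k (a : sg_type (S i)) :
  subcomplex_diff k (subcomplex_diff j a) = 0.
Proof. by apply: sg_inj; rewrite /= cdiffK. Qed.

Definition subcomplex : complex :=
  Complex subcomplex_diff_is_zmod_morphism subcomplex_diff_shape subcomplex_diffK.
End Subcomplex.

Section Support.
Context {d} {X : finPOrderType d}.
Implicit Types (n m : int) (x y z p q t : X).

Definition supported (F : sheaf X) p (S : pred X) (a : F p) :=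
  forall t, (p <= t)%O -> ~~ S t -> res F p t a = 0.

Fact supported0 (F : sheaf X) p (S : pred X) : @supported F p S 0.
Proof. by move=> t _ _; exact: raddf0. Qed.

Fact supportedB (F : sheaf X) p (S : pred X) (a b : F p) :
  supported S a -> supported S b -> supported S (a - b).
Proof. by move=> ha hb t pt St; rewrite raddfB /= ha // hb // subr0. Qed.

Definition support (F : sheaf X) p (S : pred X) : subgroup (F p) :=
  Subgroup (@supported0 F p S) (@supportedB F p S).

Lemma supported_smap (F G : sheaf X) p S (f : sheaf_map F G) (a : F p) :
  supported S a -> supported S (f p a).
Proof. by move=> ha t pt St; rewrite smap_res ha // raddf0. Qed.

(* Gamma_S(I)_p; for S = {t <= q} this is Hom(Z_[p,q], I). *)
Definition supp_complex (I : sheaf_complex X) p (S : pred X) : complex :=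
  @subcomplex (stalk_complex I p) (fun n => support (I n) p S)
    (fun i j a => @supported_smap (I i) (I j) p S (sdiff I i j) a).

Section SuppMap.
Variables (I I' : sheaf_complex X) (f : sheaf_complex_map I I') (p : X) (S : pred X).

Definition supp_map_fun n (a : supp_complex I p S n) : supp_complex I' p S n :=
  @sg_elt _ (support (I' n) p S) _ (supported_smap (f n) (sg_memP a)).

Fact supp_map_is_zmod_morphism n : zmod_morphism (@supp_map_fun n).
Proof. by move=> a b; apply: sg_inj; rewrite /= raddfB. Qed.

Fact supp_map_diff i j a : cdiff (supp_complex I' p S) i j (@supp_map_fun i a) =
  @supp_map_fun j (cdiff (supp_complex I p S) i j a).
Proof. by apply: sg_inj; rewrite /= scmap_diff. Qed.

Definition supp_map : complex_map (supp_complex I p S) (supp_complex I' p S) :=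
  ComplexMap supp_map_is_zmod_morphism supp_map_diff.
End SuppMap.

Section SuppRestrict.
Variables (I : sheaf_complex X) (p q : X) (S S' : pred X).
Hypothesis SS' : forall t, (p <= q)%O -> (q <= t)%O -> S t -> S' t.

Fact supported_res (F : sheaf X) (a : F p) : supported S a -> supported S' (res F p q a).
Proof.
move=> ha t qt S't; have [pq|npq] := boolP (p <= q)%O; last first.
  by rewrite (res_shape _ npq) raddf0.
rewrite res_comp // ha ?(le_trans pq) //; apply: contra S't; exact: SS'.
Qed.

(** One construction for two maps: with p = q it enlarges the support, with p < q it restricts to a
    smaller neighbourhood. *)
Definition supp_res_fun n (a : supp_complex I p S n) : supp_complex I q S' n :=
  @sg_elt _ (support (I n) q S') _ (supported_res (sg_memP a)).

Fact supp_res_is_zmod_morphism n : zmod_morphism (@supp_res_fun n).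
Proof. by move=> a b; apply: sg_inj; rewrite /= raddfB. Qed.

Fact supp_res_diff i j a : cdiff (supp_complex I q S') i j (@supp_res_fun i a) =
  @supp_res_fun j (cdiff (supp_complex I p S) i j a).
Proof. by apply: sg_inj; rewrite /= smap_res. Qed.

Definition supp_res : complex_map (supp_complex I p S) (supp_complex I q S') :=
  ComplexMap supp_res_is_zmod_morphism supp_res_diff.

End SuppRestrict.
End Support.

(** * Morphisms out of a point sheaf *)

Section PointEvaluation.
Context {d} {X : finPOrderType d}.
Implicit Types (n m : int) (x y z t : X).

(** The stalk is a conditional that becomes [int] only after rewriting, so its generator is obtained
    from an existence statement and then chosen. *)
Lemma point_stalk_gen q : exists e : point_stalk (X := X) q int q,
  (forall w, exists k : int, w = e *~ k) /\ (forall k : int, e *~ k = 0 -> k = 0).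
Proof.
rewrite /point_stalk eqxx; exists (1 : int).
by split=> [z|k]; rewrite ?intz //; exists z; rewrite intz.
Qed.

Lemma point_stalk_eq0 q x : x != q -> zmod_trivial (point_stalk q int x).
Proof. by move=> /negPf ne; rewrite /point_stalk ne => a; exact: zero_group_eq0. Qed.

Lemma single_eq0 (F : sheaf X) n x : n != 0 -> zmod_trivial (single_sheaf F n x).
Proof. by move=> /negPf ne; rewrite /= ne; exact: zero_group_eq0. Qed.

Variables (q : X) (U : {set X}) (I : sheaf_complex X).
Hypothesis upU : forall x y, x \in U -> (x <= y)%O -> y \in U.
Hypothesis qU : q \in U.
Local Notation Zq := (point_sheaf q int).

Definition point_one : Zq q := projT1 (cid (point_stalk_gen q)).

Lemma point_oneP (w : Zq q) : exists k : int, w = point_one *~ k.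
Proof. by have [h _] := projT2 (cid (point_stalk_gen q)); exact: h. Qed.

Lemma point_one_free (k : int) : point_one *~ k = 0 -> k = 0.
Proof. by have [_ h] := projT2 (cid (point_stalk_gen q)); exact: h. Qed.

Lemma res_point_one t : ~~ (t <= q)%O -> res Zq q t point_one = 0.
Proof. by move=> tq; rewrite /= transport_neq //; apply: contraNneq tq => <-. Qed.

Fact point_eval_subproof n (f : hom U (single_sheaf Zq) I n) :
  supported [pred t | (t <= q)%O] (f 0 n q point_one).
Proof.
move=> t qt; rewrite inE => tq; rewrite hom_res ?(upU qU) //.
by rewrite [res _ _ _ _]res_point_one // raddf0.
Qed.

Definition point_eval_fun n (f : hom U (single_sheaf Zq) I n) :
  supp_complex I q [pred t | (t <= q)%O] n :=
  @sg_elt _ (support (I n) q [pred t | (t <= q)%O]) _ (point_eval_subproof f).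

Fact point_eval_is_zmod_morphism n : zmod_morphism (@point_eval_fun n).
Proof. by move=> f g; apply: sg_inj. Qed.

Fact point_eval_diff i j (f : hom U (single_sheaf Zq) I i) :
  cdiff (supp_complex I q [pred t | (t <= q)%O]) i j (point_eval_fun f) =
  point_eval_fun (hom_diff j f).
Proof.
apply: sg_inj.
change (sdiff I i j q (f 0 i q point_one) = hom_diff j f 0 j q point_one).
have [->|ne] := eqVneq j (i + 1); last first.
  by rewrite hom_diff_shape // sdiff_shape.
by rewrite (hom_diffE i 1) // raddf0 mul0rz subr0.
Qed.

Definition point_eval : complex_map (hom_complex U (single_sheaf Zq) I)
    (supp_complex I q [pred t | (t <= q)%O]) :=
  @ComplexMap (hom_complex U (single_sheaf Zq) I) _ point_eval_fun
    point_eval_is_zmod_morphism point_eval_diff.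

(** A morphism from Z_{q} is determined by the image of 1, which can be any element of the stalk at
    q whose restrictions to all t > q vanish. The open set U only has to contain q, so the stalks of
    the dual at all x <= q are computed by one complex. *)
Lemma point_eval_quasi_iso : quasi_iso point_eval.
Proof.
apply: bijective_quasi_iso => n.
  move=> f g /(congr1 (@sg_val _ _)) /= fg; apply: hom_eqP => p0 q0 x a.
  have [p00|p00] := eqVneq p0 0; last by rewrite (single_eq0 p00 a) !raddf0.
  subst p0; have [q0n|q0n] := eqVneq q0 n; last first.
    by rewrite !hom_shape // add0r q0n.
  subst q0; have [xq|xq] := eqVneq x q; last first.
    by rewrite (point_stalk_eq0 xq a) !raddf0.
  subst x; have [k ->] := point_oneP a.
  by rewrite !raddfMz /= fg.
move=> a.
pose coef (w : Zq q) : int := projT1 (cid (point_oneP w)).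
have coefP w : w = point_one *~ coef w := projT2 (cid (point_oneP w)).
have coef_uniq k l : point_one *~ k = point_one *~ l -> k = l.
  by move=> /eqP; rewrite -subr_eq0 -mulrzBr => /eqP/point_one_free/subr0_eq.
have coefB : zmod_morphism coef.
  by move=> v w; apply: coef_uniq; rewrite mulrzBr -!coefP.
have coef0 : coef 0 = 0 by rewrite -(subrr 0) coefB subrr.
(* The transport makes this zero for x different from q; compatibility with restriction from q to y
   > q is the support condition on [a]. *)
pose g x (b : single_sheaf Zq 0 x) : I n x :=
  res (I n) q x (sg_val a *~ coef (transport (point_stalk q int) x q b)).
have g0 x b : x != q -> g x b = 0.
  by move=> xq; rewrite /g transport_neq // coef0 mulr0z raddf0.
have [||||h [hg _]] := @hom_concentrated _ _ U (single_sheaf Zq) I n 0 n g.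
- by rewrite add0r.
- by move=> x b c; rewrite /g !(raddfB, coefB, mulrzBr).
- by move=> x b xU; apply: g0; apply: contraNneq xU => ->.
- move=> x y b xU yU xy; have [yq|yq] := eqVneq y q; last first.
    rewrite [RHS]g0 //; have [xq|xq] := eqVneq x q; last by rewrite g0 // raddf0.
    subst x; rewrite /g res_comp // raddfMz /= (sg_memP a) ?mul0rz //=.
    by apply: contra yq => yx; rewrite eq_le xy yx.
  subst y; have [xq|xq] := eqVneq x q; last first.
    by rewrite g0 // raddf0 [res _ _ _ _]transport_neq // /g raddf0 coef0 mulr0z raddf0.
  by subst x; rewrite !res_id.
exists h; apply: sg_inj; rewrite /= hg /g res_id transport_id.
by rewrite (coef_uniq _ 1 (esym (coefP _))).
Qed.
End PointEvaluation.

(** * Comparison of injective resolutions *)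

Section Homotopy.
Context {d} {X : finPOrderType d}.
Implicit Types (n m i j p q : int) (x y : X).

Definition id_sheaf_map (F : sheaf X) : sheaf_map F F :=
  @SheafMap d X F F (fun _ a => a) (fun _ _ _ => erefl) (fun _ _ _ => erefl).

Definition id_map (A : sheaf_complex X) : sheaf_complex_map A A :=
  @SheafComplexMap d X A A (fun n => id_sheaf_map (A n)) (fun _ _ _ _ => erefl).

Section Comp.
Variables (A B C : sheaf_complex X).
Variables (g : sheaf_complex_map B C) (f : sheaf_complex_map A B).

Fact comp_is_zmod_morphism n x : zmod_morphism (fun a => g n x (f n x a)).
Proof. by move=> a b; rewrite !raddfB. Qed.

Fact comp_res n x y a : res (C n) x y (g n x (f n x a)) = g n y (f n y (res (A n) x y a)).
Proof. by rewrite !smap_res. Qed.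

Fact comp_diff i j x a : sdiff C i j x (g i x (f i x a)) = g j x (f j x (sdiff A i j x a)).
Proof. by rewrite !scmap_diff. Qed.

Definition comp_map : sheaf_complex_map A C :=
  @SheafComplexMap d X A C
    (fun n => @SheafMap d X _ _ _ (@comp_is_zmod_morphism n) (@comp_res n)) comp_diff.
End Comp.

Section HomOfMap.
Variables (A B : sheaf_complex X) (f : sheaf_complex_map A B).

Definition hom_of_map_fun : hom_family A B :=
  fun p q x a => transport (fun n => B n x) p q (f p x a).

Fact hom_of_map_subproof : hom_of_map_fun \in is_hom setT A B 0.
Proof.
rewrite unfold_in; apply/asboolP; split=> [p q x a b|p q x a|p q x y a _ _ _].
- by rewrite /hom_of_map_fun !raddfB.
- by rewrite addr0 inE orbF => ne; rewrite /hom_of_map_fun transport_neq // eq_sym.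
- by rewrite /hom_of_map_fun res_transport smap_res.
Qed.

Definition hom_of_map : hom_complex setT A B 0 := Hom hom_of_map_subproof.

Lemma hom_of_mapE n x a : hom_fun hom_of_map n n x a = f n x a.
Proof. by rewrite /hom_fun /= /hom_of_map_fun transport_id. Qed.

Lemma hom_of_map_cyc : cyc hom_of_map.
Proof.
apply: cyc_next; rewrite -[cdiff _ _ _ _]/(hom_diff (0 + 1) (hom_of_map : hom _ _ _ _)).
apply: hom_eqP => p q x a.
have [->|ne] := eqVneq q (p + (0 + 1)); last by rewrite !hom_shape ?ne.
by rewrite add0r (hom_diffE p (p + 1)) // !hom_of_mapE scmap_diff subrr.
Qed.
End HomOfMap.

Lemma cyc_hom_of_map (A B : sheaf_complex X) (f : hom_complex setT A B 0) : cyc f ->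
  exists g : sheaf_complex_map A B, f = hom_of_map g.
Proof.
move=> cf; pose F : hom setT A B 0 := f.
have fdiff i j x a : sdiff B i j x (F i i x a) = F j j x (sdiff A i j x a).
  have [->|ne] := eqVneq j (i + 1); last by rewrite !sdiff_shape ?raddf0.
  have : hom_diff (0 + 1) F i (i + 1) x a = 0.
    exact: (congr1 (fun h : hom setT A B (0 + 1) => h i (i + 1) x a) (cf (0 + 1))).
  by rewrite (hom_diffE i (i + 1)) // => /subr0_eq.
have fres n x y a : res (B n) x y (F n n x a) = F n n y (res (A n) x y a).
  have [xy|nxy] := boolP (x <= y)%O; last by rewrite !res_shape ?raddf0.
  by rewrite hom_res.
exists (@SheafComplexMap d X A B
  (fun n => @SheafMap d X _ _ _ (@hom_additive d X _ _ _ _ F n n) (@fres n)) fdiff).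
apply: hom_eqP => p q x a; have [<-|ne] := eqVneq p q; first by rewrite hom_of_mapE.
by rewrite !hom_shape // addr0 eq_sym ne.
Qed.

Definition homotopic (A B : sheaf_complex X) (f g : sheaf_complex_map A B) :=
  bnd (hom_of_map f - hom_of_map g).

Lemma homotopic_ext A B (f f' g g' : sheaf_complex_map A B) :
  (forall n x a, f n x a = f' n x a) -> (forall n x a, g n x a = g' n x a) ->
  homotopic f g -> homotopic f' g'.
Proof.
have E (h h' : sheaf_complex_map A B) : (forall n x a, h n x a = h' n x a) ->
    hom_of_map h = hom_of_map h'.
  by move=> hh; apply: hom_eqP => p q x a; rewrite /hom_fun /= /hom_of_map_fun hh.
by rewrite /homotopic => /E -> /E ->.
Qed.

Lemma homotopic_trans A B (f g h : sheaf_complex_map A B) :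
  homotopic f g -> homotopic g h -> homotopic f h.
Proof.
by rewrite /homotopic => fg gh; rewrite -(subrK (hom_of_map g) (hom_of_map f)) -addrA; exact: bndD.
Qed.

Lemma homotopicE A B (f g : sheaf_complex_map A B) : homotopic f g ->
  exists k : hom setT A B (-1), forall n m x a, m = n - 1 -> 
    f n x a - g n x a = sdiff B m n x (k n m x a) + k (n + 1) n x (sdiff A n (n + 1) x a).
Proof.
move=> /(bnd_from (i := -1)) [//|k fg]; exists k => n m x a mE.
have : (hom_of_map f - hom_of_map g : hom setT A B 0) n n x a
    = hom_diff 0 (k : hom setT A B (-1)) n n x a.
  exact: (congr1 (fun h : hom setT A B 0 => h n n x a) fg).
rewrite homB !hom_of_mapE (hom_diffE m (n + 1)) //; last by rewrite mE subrK.
(* A homotopy has degree -1, and the sign (-1)^(-1) turns the difference in [hom_diff] into the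
   usual dk + kd. *)
by move=> ->; rewrite exprN1 invrN1 mulrNz opprK.
Qed.

Lemma homotopic_postcomp A B C (h : sheaf_complex_map B C) (f g : sheaf_complex_map A B) :
  homotopic f g -> homotopic (comp_map h f) (comp_map h g).
Proof.
move=> /(bnd_from (i := -1)) [//|k fg].
have kP : ((fun p q x a => h q x (hom_fun k p q x a)) : hom_family A C)
    \in is_hom setT A C (-1).
  rewrite unfold_in; apply/asboolP; split=> [p q x a b|p q x a|p q x y a xU yU xy].
  - by rewrite !raddfB.
  - by move=> ne; rewrite hom_shape // raddf0.
  - by rewrite smap_res hom_res.
exists (-1), (Hom kP).
rewrite -[cdiff _ _ _ _]/(hom_diff 0 (Hom kP)); apply: hom_eqP => p q x a.
have [->|ne] := eqVneq q p; last by rewrite !hom_shape // addr0 ne.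
have pE : p = p - 1 + 1 by rewrite subrK.
have : (hom_of_map f - hom_of_map g : hom setT A B 0) p p x a
    = hom_diff 0 (k : hom setT A B (-1)) p p x a.
  exact: (congr1 (fun h : hom setT A B 0 => h p p x a) fg).
rewrite !homB !hom_of_mapE !(hom_diffE (p - 1) (p + 1)) // => /= fgE.
by rewrite -raddfB /= fgE raddfB /= smapMz scmap_diff.
Qed.

Section Resolutions.
Variables (A I : sheaf_complex X) (s : sheaf_complex_map A I).
Hypothesis qs : sheaf_quasi_iso s.

Section Target.
Variable J : sheaf_complex X.
Hypothesis lowJ : bounded_below J.
Hypothesis injJ : forall n, injective_sheaf (J n).

Let qp : quasi_iso (hom_precomp setT J s) :=
  precomp_quasi_iso (fun _ _ _ _ => in_setT _) lowJ injJ qs.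

Let precompE (f : sheaf_complex_map I J) :
  hom_precomp setT J s 0 (hom_of_map f) = hom_of_map (comp_map f s).
Proof. by apply: hom_eqP => p q x a. Qed.

(** Degree 0 cocycles of the Hom complex are the maps of complexes, so this is surjectivity of
    precomposition with s on H^0; [map_extension_uniq] is its injectivity. *)
Lemma map_extension (t : sheaf_complex_map A J) :
  exists f : sheaf_complex_map I J, homotopic t (comp_map f s).
Proof.
have [g0 /cyc_hom_of_map[f ->] tg] := quasi_iso_lift qp (hom_of_map_cyc t).
by exists f; rewrite /homotopic -precompE.
Qed.

Lemma map_extension_uniq (f g : sheaf_complex_map I J) :
  homotopic (comp_map f s) (comp_map g s) -> homotopic f g.
Proof.
move=> fg; apply: (quasi_iso_bnd qp); first by apply: cycB; exact: hom_of_map_cyc.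
by move: fg; rewrite /homotopic -!precompE -raddfB.
Qed.
End Target.
End Resolutions.

(** A homotopy consists of sheaf morphisms; these commute with restrictions and so preserve
    supports. *)
Lemma homotopic_supp (I J : sheaf_complex X) (f g : sheaf_complex_map I J) (p : X) S n
    (z : supp_complex I p S n) : homotopic f g -> cyc z ->
  bnd (supp_map f p S n z - supp_map g p S n z).
Proof.
move=> /homotopicE[k kE] cz.
have kS : supported S (k n (n - 1) p (sg_val z)).
  move=> t pt St; rewrite hom_res ?inE // (sg_memP z) // raddf0 //.
exists (n - 1), (@sg_elt _ (support (J (n - 1)) p S) _ kS); apply: sg_inj => /=.
rewrite (kE n (n - 1)) //.
by have /(congr1 (@sg_val _ _))/= -> := cz (n + 1); rewrite raddf0 addr0.
Qed.

(** Two injective resolutions of the same complex are homotopy equivalent, and the homotopies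
    restrict to the complexes with supports. *)
Lemma resolution_sphere (O I I' : sheaf_complex X) (s : sheaf_complex_map O I)
    (s' : sheaf_complex_map O I') (p : X) S m :
  injective_resolution s -> injective_resolution s' ->
  sphere_like (supp_complex I' p S) m -> sphere_like (supp_complex I p S) m.
Proof.
move=> [lowI injI qs] [lowI' injI' qs'].
have [f sf] := map_extension qs lowI' injI' s'.
have [g sg] := map_extension qs' lowI injI s.
have gf : homotopic (id_map I) (comp_map g f).
  apply: (map_extension_uniq qs lowI injI).
  by apply: homotopic_ext (homotopic_trans sg (homotopic_postcomp g sf)).
have fg : homotopic (id_map I') (comp_map f g).
  apply: (map_extension_uniq qs' lowI' injI').
  by apply: homotopic_ext (homotopic_trans sf (homotopic_postcomp f sg)).
suff qf : quasi_iso (supp_map f p S) by move/(quasi_iso_sphere qf).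
apply/quasi_isoP; split=> n.
  move=> z cz /(cmap_bnd (supp_map g p S)) bz.
  rewrite -[z](subrK (supp_map g p S n (supp_map f p S n z))); apply: bndD bz.
  have := homotopic_supp gf cz.
  by congr bnd; congr (_ - _); apply: sg_inj.
move=> w cw; exists (supp_map g p S n w); first exact: cmap_cyc.
have := homotopic_supp fg cw.
by congr bnd; congr (_ - _); apply: sg_inj.
Qed.

Lemma codimension_sphere (O I : sheaf_complex X) (s : sheaf_complex_map O I)
    (phi : X -> int) (p : X) :
  injective_resolution s -> codimension_function O phi ->
  sphere_like (supp_complex I p [pred t | (t <= p)%O]) (phi p).
Proof.
move=> hs [I' [s' [hs' /(_ p) /derived_iso_sphere hp]]].
apply: (resolution_sphere hs hs').
by apply/(quasi_iso_sphere (@point_eval_quasi_iso _ _ p setT I' _ _)) => // *; exact: in_setT.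
Qed.
End Homotopy.

(** * The dual of a point sheaf *)

Section ClosedPoint.
Context {d} {X : finPOrderType d}.
Implicit Types (n : int) (x y z t : X).
Variables (q : X) (m : int).

(** Every stalk is a subgroup of [int], the whole of it in degree m on the closure of q and zero
    otherwise, so restrictions need no cast between Z and a zero group. *)
Definition closed_mem n x (k : int) := ~~ ((n == m) && (x <= q)%O) -> k = 0.

Fact closed_mem0 n x : closed_mem n x 0.
Proof. by []. Qed.

Fact closed_memB n x k l : closed_mem n x k -> closed_mem n x l -> closed_mem n x (k - l).
Proof. by move=> hk hl h; rewrite hk // hl. Qed.

Definition closed_sg n x : subgroup int := Subgroup (@closed_mem0 n x) (@closed_memB n x).

Fact closed_res_subproof n x y (k : sg_type (closed_sg n x)) :
  closed_sg n y (if (x <= y)%O && (y <= q)%O then sg_val k else 0).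
Proof.
move=> h; case: ifP => // /andP[xy yq]; apply: (sg_memP k).
by move: h; rewrite yq (le_trans xy yq).
Qed.

Definition closed_res n x y (k : sg_type (closed_sg n x)) : sg_type (closed_sg n y) :=
  sg_elt (@closed_res_subproof n x y k).

Fact closed_res_is_zmod_morphism n x y : zmod_morphism (@closed_res n x y).
Proof. by move=> k l; apply: sg_inj => /=; case: ifP; rewrite ?subr0. Qed.

Fact closed_res_shape n x y k : ~~ (x <= y)%O -> @closed_res n x y k = 0.
Proof. by move=> /negPf xy; apply: sg_inj; rewrite /= xy. Qed.

Fact closed_res_id n x k : @closed_res n x x k = k.
Proof.
apply: sg_inj; rewrite /= lexx /=; case: ifP => // xq.
by rewrite (sg_memP k) // xq andbF.
Qed.

Fact closed_res_comp n x y z k : (x <= y)%O -> (y <= z)%O ->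
  closed_res z (@closed_res n x y k) = closed_res z k.
Proof.
move=> xy yz; apply: sg_inj; rewrite /= xy yz (le_trans xy yz) /=.
by case: ifP => // zq; rewrite (le_trans yz zq).
Qed.

Definition closed_sheaf n : sheaf X :=
  Sheaf (@closed_res_is_zmod_morphism n) (@closed_res_shape n) (@closed_res_id n)
    (@closed_res_comp n).

(* The constant sheaf Z on the closure {x | x <= q} of q, placed in degree m. *)
Definition closed_complex : sheaf_complex X :=
  @SheafComplex d X closed_sheaf (fun i j => zero_sheaf_map _ _)
    (fun _ _ _ _ _ => erefl) (fun _ _ _ _ _ => erefl).

Lemma closed_eq0 n x : ~~ ((n == m) && (x <= q)%O) -> zmod_trivial (closed_complex n x).
Proof. by move=> h k; apply: sg_inj; exact: (sg_memP k). Qed.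

Fact closed_one_subproof x : (x <= q)%O -> closed_sg m x 1.
Proof. by move=> xq; rewrite /= /closed_mem eqxx xq. Qed.

Definition closed_one x (xq : (x <= q)%O) : closed_complex m x :=
  sg_elt (closed_one_subproof xq).

Lemma closed_oneP x (xq : (x <= q)%O) w : w = closed_one xq *~ sg_val w.
Proof. by apply: sg_inj; rewrite sg_valMz /= intz. Qed.
End ClosedPoint.

Section HomRestriction.
Context {d} {X : finPOrderType d}.
Variables (F G : sheaf_complex X) (U : {set X}).

Fact hom_to_subproof n (f : hom setT F G n) :
  ((fun p q x a => if x \in U then hom_fun f p q x a else 0) : hom_family F G)
    \in is_hom U F G n.
Proof.
rewrite unfold_in; apply/asboolP; split=> [p q x a b|p q x a|p q x y a xU yU xy].
- by case: ifP => _; rewrite ?subr0 // raddfB.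
- case: ifP => xU; rewrite ?orbT // orbF => qE; rewrite hom_shape // qE //.
- by rewrite xU yU hom_res ?inE.
Qed.

Definition hom_to n (f : hom setT F G n) : hom U F G n := Hom (hom_to_subproof f).

Lemma hom_toE n (f : hom setT F G n) p q x a :
  hom_to f p q x a = if x \in U then f p q x a else 0.
Proof. by []. Qed.

Lemma hom_to_diff n k (f : hom setT F G n) : hom_diff k (hom_to f) = hom_to (hom_diff k f).
Proof.
apply: hom_eqP => p q x a; rewrite hom_toE.
rewrite /hom_fun /= /hom_diff_fun !hom_toE.
by case: ifP => _; case: ifP => _ //; rewrite raddf0 mul0rz subr0.
Qed.
End HomRestriction.
Arguments hom_to {d X F G} U {n} f.

Section DualOfPoint.
Context {d} {X : finPOrderType d}.
Implicit Types (n : int) (x y z t : X).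
Variables (I : sheaf_complex X) (q : X) (m : int).
Local Notation Zq := (single_sheaf (point_sheaf q int)).
Local Notation Eq := (supp_complex I q [pred t | (t <= q)%O]).
Hypothesis sphereE : sphere_like Eq m.
Local Notation M := (sheaf_hom Zq I).
Local Notation Z := (closed_complex q m).

Lemma hom_point_eq0 (U : {set X}) n : q \notin U -> zmod_trivial (hom U Zq I n).
Proof.
move=> qU f; apply: hom_eqP => p0 q0 x a.
have [xU|xU] := boolP (x \in U); last by rewrite !hom_shape ?xU ?orbT.
have [p00|p00] := eqVneq p0 0; last by rewrite (single_eq0 p00 a) !raddf0.
subst p0; rewrite (@point_stalk_eq0 _ _ q x _ a) ?raddf0 //.
by apply: contraNneq qU => <-.
Qed.

(** The stalk of the dual at x is zero unless x <= q, and then evaluation at q identifies its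
    cohomology with that of [Eq]. To get a morphism of sheaves, the generator is lifted once to a
    morphism [e] on all of X, and 1 at x goes to the restriction of [e] to U_x. *)
Lemma dual_of_point : exists u : sheaf_complex_map Z M, sheaf_quasi_iso u.
Proof.
have [exE [e0 ge]] := sphereE.
have upT x y : x \in [set: X] -> (x <= y)%O -> y \in [set: X] by rewrite !inE.
have upx x y z : y \in up_set x -> (y <= z)%O -> z \in up_set x.
  by rewrite !inE; exact: le_trans.
have [ce _ _] := ge.
have qT := point_eval_quasi_iso I upT (in_setT q).
have [e ce' he] := quasi_iso_lift qT ce.
have {ge he} ge := generatesP ge (cmap_cyc _ ce') he.
(* [e] in degree m and zero in the other degrees, which defines [u] uniformly in n. *)
pose E n : hom setT Zq I n := transport (fun n => hom setT Zq I n : zmodType) m n e.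
have Em : E m = e by exact: transport_id.
have En n : n != m -> E n = 0 by move=> ne; rewrite /E transport_neq // eq_sym.
have dE n k : hom_diff k (E n) = 0.
  have [->|ne] := eqVneq n m; first by rewrite Em; exact: ce'.
  by rewrite En //; exact: (raddf0 (cdiff (hom_complex setT Zq I) n k)).
pose u n x (k : Z n x) : M n x := hom_to (up_set x) (E n) *~ sg_val k.
have uB n x : zmod_morphism (@u n x) by move=> k l; rewrite /u sg_valB mulrzBr.
have ures n x y k : res (M n) x y (@u n x k) = @u n y (res (Z n) x y k).
  have [xy|nxy] := boolP (x <= y)%O; last first.
    by rewrite !res_shape // /u sg_val0 mulr0z.
  have [yq|nyq] := boolP (y <= q)%O; last first.
    have triv := @hom_point_eq0 (up_set y) n; rewrite inE in triv.
    exact: etrans (triv nyq _) (esym (triv nyq _)).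
  rewrite /u raddfMz /= xy yq /=; congr (_ *~ _).
  apply: hom_eqP => p0 q0 z a; rewrite hom_restrictE !hom_toE xy !inE /=.
  by case: ifP => // yz; rewrite (le_trans xy yz).
have udiff i j x k : sdiff M i j x (@u i x k) = @u j x (sdiff Z i j x k).
  rewrite {2}/u sg_val0 mulr0z /u smapMz.
  have -> : sdiff M i j x (hom_to (up_set x) (E i)) = hom_to (up_set x) (hom_diff j (E i)).
    exact: hom_to_diff.
  rewrite dE -[RHS](mul0rz _ (sg_val k)); congr (_ *~ _).
  by apply: hom_eqP => p0 q0 z a; rewrite hom_toE; case: ifP.
pose U : sheaf_complex_map Z M := @SheafComplexMap d X Z M
  (fun n => @SheafMap d X (Z n) (M n) (@u n) (@uB n) (@ures n)) udiff.
exists U => x; have [xq|xq] := boolP (x <= q)%O; last first.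
  have trivM n : zmod_trivial (M n x) by apply: hom_point_eq0; rewrite inE.
  have trivZ n : zmod_trivial (Z n x) by apply: closed_eq0; rewrite (negPf xq) andbF.
  apply: bijective_quasi_iso => n; first by move=> k l _; rewrite (trivZ n k) (trivZ n l).
  by move=> w; exists 0; exact: etrans (trivM n _) (esym (trivM n w)).
have qx : q \in up_set x by rewrite inE.
have qi := point_eval_quasi_iso I (upx x) qx.
apply: (@generator_quasi_iso (stalk_complex Z x) (stalk_complex M x)
  (stalk_complex_map U x) m (closed_one m xq)) => [w|n ne|n ne|].
- by exists (sg_val w); exact: closed_oneP.
- by apply: closed_eq0; rewrite (negPf ne).
- exact/(quasi_iso_exact qi)/exE.
have ge1 : generates (hom_to (up_set x) e : hom_complex (up_set x) Zq I m).
  apply/(quasi_iso_generates qi).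
    apply: cyc_next; rewrite -[LHS]/(hom_diff (m + 1) (hom_to (up_set x) e)) hom_to_diff.
    rewrite [hom_diff _ _](ce' (m + 1)).
    by apply: hom_eqP => p0 q0 z a; rewrite hom_toE; case: ifP.
  rewrite (_ : point_eval _ _ _ _ _ = point_eval I upT (in_setT q) m e) //.
  by apply: sg_inj; exact: ifT.
by rewrite -Em in ge1.
Qed.
End DualOfPoint.

(** * Acyclicity from biduality *)

Section Biduality.
Context {d} {X : finPOrderType d}.
Implicit Types (n : int) (x y z t p q : X).

Lemma fg_point_sheaf q : fg_cohomology (single_sheaf (point_sheaf (X := X) q int)).
Proof.
move=> n x; set F := single_sheaf _.
suff [e eg] : exists e : F n x, forall w, exists k : int, w = e *~ k.
  have ce : cyc (e : stalk_complex F x n) by [].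
  have [e' ee'] := cyc_cocycle ce.
  exists 1%N, (fun=> cohomology_class e') => a; have [k kP] := eg (val (cohomology_repr a)).
  exists (fun=> k); rewrite big_ord1 -[a]class_reprK.
  have -> : cohomology_repr a = e' *~ k.
    by apply: val_inj; rewrite kP raddfMz /= ee'.
  by rewrite /cohomology_class raddfMz.
have [n0|n0] := eqVneq n 0; last by exists 0 => w; exists 0; exact: single_eq0.
subst n; have [xq|xq] := eqVneq x q; last by exists 0 => w; exists 0; exact: (point_stalk_eq0 xq).
by subst x; exists (point_one q); exact: point_oneP.
Qed.

Variables (I : sheaf_complex X).
Hypothesis lowI : bounded_below I.
Hypothesis injI : forall n, injective_sheaf (I n).
Hypothesis bidualI : forall F, fg_cohomology F -> sheaf_quasi_iso (biduality F I).

(** The stalk of Z_{q} at p is zero, so the bidual is acyclic there; replacing the dual by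
    [closed_complex], so is Hom(Z_closed[-m], I) over U_p. A cocycle [a] supported in {t <= q}
    defines a cocycle of the latter by sending 1 at x to the restriction of [a]. *)
Lemma bidual_exact p q n (m : int) : (p < q)%O ->
  sphere_like (supp_complex I q [pred t | (t <= q)%O]) m ->
  exact_at (supp_complex I p [pred t | (t <= q)%O]) n.
Proof.
move=> pq /dual_of_point[u qu].
pose Zq : sheaf_complex X := single_sheaf (point_sheaf q int).
have exM k : exact_at (hom_complex (up_set p) (sheaf_hom Zq I) I) k.
  apply/(quasi_iso_exact (bidualI (@fg_point_sheaf q) p)) => z _.
  suff -> : z = 0 by exact: bnd0.
  have [k0|k0] := eqVneq k 0; last exact: single_eq0.
  by subst k; apply: (@point_stalk_eq0 _ _ q p); rewrite (lt_eqF pq).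
have upp x y : x \in up_set p -> (x <= y)%O -> y \in up_set p.
  by rewrite !inE; exact: le_trans.
have exZ k : exact_at (hom_complex (up_set p) (closed_complex q m) I) k.
  exact/(quasi_iso_exact (precomp_quasi_iso upp lowI injI qu))/exM.
move=> a ca.
pose g x (k : closed_complex q m m x) : I n x := res (I n) p x (sg_val a) *~ sg_val k.
have a0 x : (p <= x)%O -> ~~ (x <= q)%O -> res (I n) p x (sg_val a) = 0 := sg_memP a x.
have [|||x y k|f [fg f0]] := @hom_concentrated _ _ (up_set p) _ _ (n - m) m n g.
- by rewrite addrC subrK.
- by move=> x k l; rewrite /g sg_valB mulrzBr.
- by move=> x k; rewrite inE => px; rewrite /g res_shape // mul0rz.
- rewrite !inE => px py xy; rewrite /g raddfMz /= res_comp // xy /=.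
  by case: ifP => // /negbT yq; rewrite a0 // !mul0rz.
have cf : cyc (f : hom_complex (up_set p) (closed_complex q m) I (n - m)).
  apply: cyc_next; rewrite -[LHS]/(hom_diff (n - m + 1) f).
  apply: hom_eqP => p0 q0 x k.
  have [q0E|q0E] := eqVneq q0 (p0 + (n - m + 1)); last by rewrite !hom_shape ?q0E.
  have [p0E|p0E] := eqVneq p0 m; last first.
    by rewrite (hom_diffE (q0 - 1) (p0 + 1)) ?subrK // f0 // !raddf0 mul0rz subr0.
  subst p0; rewrite (hom_diffE n (m + 1)) //; last by rewrite q0E; lia.
  rewrite fg /g !raddf0 mul0rz subr0 smapMz.
  have /(congr1 (@sg_val _ _)) /= da := ca q0.
  by rewrite -smap_res da raddf0 mul0rz.
have [h fh] := bnd_from (i := n - m - 1) (esym (subrK _ _)) (exZ _ _ cf).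
have pq' := ltW pq.
(* The primitive of the morphism, evaluated at 1 over p, is a primitive of [a]; it has the right
   support because 1 restricts to zero off the closure of q. *)
pose b : I (n - 1) p := hom_fun h m (n - 1) p (closed_one m pq').
have bS : supported [pred t | (t <= q)%O] b.
  move=> t pt /negPf; rewrite inE => tq; rewrite hom_res ?inE //.
  suff -> : res (closed_complex q m m) p t (closed_one m pq') = 0 by rewrite raddf0.
  by apply: sg_inj; rewrite /= pt tq.
exists (n - 1), (@sg_elt _ (support (I (n - 1)) p _) _ bS); apply: sg_inj => /=.
have : f m n p (closed_one m pq') = hom_diff (n - m) h m n p (closed_one m pq').
  exact: (congr1 (fun f : hom (up_set p) (closed_complex q m) I (n - m) =>
    f m n p (closed_one m pq')) fh).
rewrite fg /g res_id mulr1z (hom_diffE (n - 1) (m + 1)) ?subrK // => ->.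
by rewrite !raddf0 mul0rz subr0.
Qed.
End Biduality.

(** * Connecting homomorphisms *)

Section ConnectingSupports.
Context {d} {X : finPOrderType d}.
Implicit Types (n : int) (x y z t p q s : X).
Variables (I : sheaf_complex X).
Hypothesis injI : forall n, injective_sheaf (I n).

Local Notation le q := [pred t | (t <= q)%O].
Local Notation lt q := [pred t | (t < q)%O].

Fact lt_le_sub s q t : (s <= s)%O -> (s <= t)%O -> lt q t -> le q t.
Proof. by move=> _ _; exact: ltW. Qed.

Fact le_le_sub s q t : (s <= q)%O -> (q <= t)%O -> le q t -> le q t.
Proof. by []. Qed.

Fact lt_lt_sub s s' q t : (s <= s')%O -> (s' <= t)%O -> lt q t -> lt q t.
Proof. by []. Qed.

Definition supp_lt_le s q : complex_map (supp_complex I s (lt q)) (supp_complex I s (le q)) :=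
  @supp_res d X I s s _ _ (@lt_le_sub s q).
Definition supp_top s q : complex_map (supp_complex I s (le q)) (supp_complex I q (le q)) :=
  @supp_res d X I s q _ _ (@le_le_sub s q).
Definition supp_lt_res s s' q :
    complex_map (supp_complex I s (lt q)) (supp_complex I s' (lt q)) :=
  @supp_res d X I s s' _ _ (@lt_lt_sub s s' q).

Section Top.
Variables (s q : X) (sq : (s < q)%O).

Lemma supp_lt_le_inj n : injective (supp_lt_le s q n).
Proof.
by move=> a b /(congr1 (@sg_val _ _)) /=; rewrite !res_id; exact: sg_inj.
Qed.

Lemma supp_lt_le_top n a : supp_top s q n (supp_lt_le s q n a) = 0.
Proof.
apply: sg_inj => /=; rewrite res_id; apply: (sg_memP a); first exact: ltW.
by rewrite /= ltxx.
Qed.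

Lemma supp_top_eq0 n (y : supp_complex I s (le q) n) :
  supp_top s q n y = 0 -> exists a, y = supp_lt_le s q n a.
Proof.
move=> /(congr1 (@sg_val _ _)) /= yq.
have yS : support (I n) s (lt q) (sg_val y).
  move=> t st; rewrite inE => tq; have [->//|tnq] := eqVneq t q.
  by apply: (sg_memP y) => //; rewrite inE le_eqVlt negb_or tnq.
by exists (sg_elt yS); apply: sg_inj; rewrite /= res_id.
Qed.

(** Since w vanishes at every t > q, it extends by zero to the union of U_q and the complement of
    the closure of q. This union is open, and flabbiness extends the section further down to s. *)
Lemma supp_top_surj n w : exists a, supp_top s q n a = w.
Proof.
pose W := [set t | (q <= t)%O || ~~ (t <= q)%O].
pose v t : I n t := res (I n) q t (sg_val w).
have v0 t : ~~ (t <= q)%O -> v t = 0.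
  move=> tq; rewrite /v; have [qt|nqt] := boolP (q <= t)%O; last by rewrite res_shape.
  exact: (sg_memP w).
have [|c [cres cW]] := @flabby d X (I n) (@injI n) W v.
  move=> x y; rewrite inE => /orP[qx xy|xq xy].
    by rewrite inE (le_trans qx xy); split=> //; rewrite /v res_comp.
  have yq : ~~ (y <= q)%O by apply: contra xq => yq; exact: le_trans xy yq.
  by rewrite inE yq orbT; split=> //; rewrite !v0 // raddf0.
have cS : support (I n) s (le q) (c s).
  by move=> t st tq; rewrite cres // cW ?v0 // inE tq orbT.
exists (sg_elt cS); apply: sg_inj; rewrite /= cres ?(ltW sq) // cW ?inE ?lexx //.
by rewrite /v res_id.
Qed.
End Top.

Variable phi : X -> int.
Hypothesis sphere : forall p, sphere_like (supp_complex I p (le p)) (phi p).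
Hypothesis exact_lt : forall p q n, (p < q)%O -> exact_at (supp_complex I p (le q)) n.

Lemma sphere_lt s q m : (s < q)%O -> m = phi q + 1 ->
  sphere_like (supp_complex I s (lt q)) m.
Proof.
move=> sq mE.
apply/(connecting_sphere (@supp_lt_le_inj s q) (@supp_lt_le_top _ _ sq)
  (@supp_top_eq0 s q) (@supp_top_surj _ _ sq) (fun n => @exact_lt _ _ n sq) mE).
exact: sphere.
Qed.

(** Connecting maps commute with restriction: one lift c of the generator at q, chosen over p,
    restricts to a lift over each s, so its differential represents the generator at all s
    simultaneously. *)
Lemma generator_lt p q m : (p < q)%O -> m = phi q + 1 ->
  exists b : supp_complex I p (lt q) m, forall s, (p <= s)%O -> (s < q)%O ->
    generates (supp_lt_res p s q m b).
Proof.
move=> pq mE; have [_ [e ge]] := sphere q; have [ce _ _] := ge.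
have [c ce'] := supp_top_surj pq e; subst e.
have [b bc] : exists b, cdiff _ (phi q) m c = supp_lt_le p q m b.
  by apply: supp_top_eq0; rewrite -cmap_diff ce.
exists b => s ps sq.
pose c' : supp_complex I s (le q) (phi q) := @supp_res d X I p s _ _ (fun _ _ _ => id) _ c.
apply/(connecting_generates (@supp_lt_le_inj s q) (@supp_lt_le_top _ _ sq)
  (@supp_top_eq0 s q) (@supp_top_surj _ _ sq) (fun n => @exact_lt _ _ n sq) mE (c := c')).
  apply: sg_inj; move/(congr1 (@sg_val _ _)): bc => /= bc.
  by rewrite res_id -smap_res bc res_id.
rewrite (_ : supp_top s q (phi q) c' = supp_top p q (phi q) c) //.
by apply: sg_inj; rewrite /= res_comp // ltW.
Qed.

Lemma covered_codim p q : covered p q -> phi p = phi q + 1.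
Proof.
case=> pq nopq; apply: (sphere_like_uniq (sphere p)).
have sub1 t : (p <= p)%O -> (p <= t)%O -> le p t -> lt q t.
  by move=> _ pt tp; rewrite inE (le_lt_trans tp).
apply/(quasi_iso_sphere (f := @supp_res d X I p p _ _ sub1)); last exact: sphere_lt.
apply: bijective_quasi_iso => n.
  by move=> a b /(congr1 (@sg_val _ _)) /=; rewrite !res_id; exact: sg_inj.
move=> b; have bS : support (I n) p (le p) (sg_val b).
  move=> t pt; rewrite inE => tp; apply: (sg_memP b) => //; rewrite inE.
  have := nopq t; rewrite lt_neqAle pt andbT negb_and => /orP[|//].
  by rewrite negbK => /eqP pE; rewrite pE lexx in tp.
by exists (sg_elt bS); apply: sg_inj; rewrite /= res_id.
Qed.
End ConnectingSupports.

(** * Sheaves on open intervals *)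

Section IntervalSheaf.
Context {d} {X : finPOrderType d}.
Variables (p q : X).
Local Notation Y := (open_interval p q).
Implicit Types (x y t : X) (r s : Y).
Local Notation lt q := [pred t | (t < q)%O].

Lemma interval_lt s : (p < val s)%O /\ (val s < q)%O.
Proof. by apply/andP; exact: (valP s). Qed.

Lemma interval_insub r t : (val r <= t)%O -> (t < q)%O ->
  exists2 s : Y, insub t = Some s & val s = t.
Proof.
move=> rt tq; have [pr _] := interval_lt r.
have h : (p < t < q)%O by rewrite (lt_le_trans pr rt).
by exists (Sub t h); rewrite ?insubT ?SubK.
Qed.

Section Extension.
Variable B : sheaf Y.

Definition ext_mem t (b : dprod B) := forall s, val s != t -> b s = 0.

Fact ext_mem0 t : ext_mem t 0.
Proof. by []. Qed.

Fact ext_memB t a b : ext_mem t a -> ext_mem t b -> ext_mem t (a - b).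
Proof. by move=> ha hb s ne; rewrite -[LHS]/(a s - b s) ha // hb // subr0. Qed.

Definition ext_sg t : subgroup (dprod B) := Subgroup (@ext_mem0 t) (@ext_memB t).

Definition ext_res_fun t t' (b : dprod B) : dprod B := fun s' =>
  if val s' == t' then if insub t is Some s then res B s s' (b s) else 0 else 0.

Lemma ext_res_funB t t' a b :
  ext_res_fun t t' (a - b) = ext_res_fun t t' a - ext_res_fun t t' b.
Proof.
apply: dprodP => s; rewrite -[RHS]/(ext_res_fun t t' a s - ext_res_fun t t' b s).
rewrite /ext_res_fun; case: ifP => _; last by rewrite subr0.
by case: insub => [r|]; rewrite ?subr0 // -raddfB.
Qed.

Fact ext_res_mem t t' b : ext_mem t' (ext_res_fun t t' b).
Proof. by move=> s /negPf ne; rewrite /ext_res_fun ne. Qed.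

Definition ext_res t t' (b : sg_type (ext_sg t)) : sg_type (ext_sg t') :=
  @sg_elt _ (ext_sg t') _ (@ext_res_mem t t' (sg_val b)).

Fact ext_res_is_zmod_morphism t t' : zmod_morphism (@ext_res t t').
Proof. by move=> a b; apply: sg_inj; exact: ext_res_funB. Qed.

Fact ext_res_shape t t' b : ~~ (t <= t')%O -> @ext_res t t' b = 0.
Proof.
move=> tt'; apply: sg_inj; apply: dprodP => s; rewrite /= /ext_res_fun.
case: eqP => // sE; case: insubP => // r _ rE.
by rewrite res_shape //; apply: contra tt'; rewrite -sE -rE.
Qed.

Fact ext_res_id t b : @ext_res t t b = b.
Proof.
apply: sg_inj; apply: dprodP => s; rewrite /= /ext_res_fun.
case: eqP => [sE|/eqP ne]; last by rewrite (sg_memP b).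
by subst t; rewrite valK res_id.
Qed.

(** Intervals are convex: if t and t'' lie in (p, q), so does t', and passing through t' does not
    lose the element. *)
Fact ext_res_comp t t' t'' b : (t <= t')%O -> (t' <= t'')%O ->
  @ext_res t' t'' (@ext_res t t' b) = @ext_res t t'' b.
Proof.
move=> h h'; apply: sg_inj; apply: dprodP => s; rewrite /= /ext_res_fun.
case: eqP => // sE; have [ps sq] := interval_lt s.
case: (insubP _ t) => [r _ rE|_]; last by case: insub => // r'; rewrite if_same raddf0.
have [||r' -> r'E] := @interval_insub r t'; rewrite ?rE //.
  by apply: le_lt_trans _ sq; rewrite sE.
by rewrite r'E eqxx res_comp // leEsub /= ?r'E ?rE ?sE.
Qed.

(* Extension by zero. A stalk is a subgroup of the product of all the stalks of
   B, which avoids casting along val s = t. *)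
Definition ext_sheaf : sheaf X :=
  Sheaf ext_res_is_zmod_morphism ext_res_shape ext_res_id ext_res_comp.

Definition ext_elt s (b : B s) : dprod B := fun r => transport B s r b.

Fact ext_elt_mem s (b : B s) : ext_mem (val s) (ext_elt b).
Proof.
by move=> r ne; rewrite /ext_elt transport_neq //; apply: contraNneq ne => ->.
Qed.

Definition ext_point s (b : B s) : ext_sheaf (val s) :=
  @sg_elt _ (ext_sg (val s)) _ (ext_elt_mem b).

Lemma ext_res_elt s s' (b : B s) :
  ext_res_fun (val s) (val s') (ext_elt b) = ext_elt (res B s s' b).
Proof.
apply: dprodP => r; rewrite /ext_res_fun /ext_elt valK transport_id.
rewrite (inj_eq val_inj); case: eqP => [->|/eqP ne]; first by rewrite transport_id.
by rewrite transport_neq // eq_sym.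
Qed.
End Extension.

Variable G : sheaf X.

Definition interval_sheaf_res s s' (a : sg_type (support G (val s) (lt q))) :
    sg_type (support G (val s') (lt q)) :=
  @sg_elt _ (support G (val s') (lt q)) _
    (@supported_res d X (val s) (val s') _ (lt q) (fun _ _ _ => id) G _ (sg_memP a)).

Fact interval_sheaf_res_is_zmod_morphism s s' : zmod_morphism (@interval_sheaf_res s s').
Proof. by move=> a b; apply: sg_inj; rewrite /= raddfB. Qed.

Fact interval_sheaf_res_shape s s' a : ~~ (s <= s')%O -> @interval_sheaf_res s s' a = 0.
Proof. by move=> h; apply: sg_inj; rewrite /= res_shape. Qed.

Fact interval_sheaf_res_id s a : @interval_sheaf_res s s a = a.
Proof. by apply: sg_inj; rewrite /= res_id. Qed.

Fact interval_sheaf_res_comp s s' s'' a : (s <= s')%O -> (s' <= s'')%O ->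
  @interval_sheaf_res s' s'' (@interval_sheaf_res s s' a) = @interval_sheaf_res s s'' a.
Proof. by move=> h h'; apply: sg_inj; rewrite /= res_comp. Qed.

(* Injectivity is preserved because {t | t < q} is closed in X and the interval
   (p, q) is open in {t | t < q}. *)
Definition interval_sheaf : sheaf Y :=
  Sheaf interval_sheaf_res_is_zmod_morphism interval_sheaf_res_shape
    interval_sheaf_res_id interval_sheaf_res_comp.

(** Extension by zero is exact and left adjoint to [interval_sheaf], and a right adjoint of an exact
    functor preserves injectives. *)
Lemma injective_interval_sheaf : injective_sheaf G -> injective_sheaf interval_sheaf.
Proof.
move=> injG A B i f inj_i.
(* The morphism into G adjoint to f, zero at points outside the interval. *)
pose v t (a : dprod A) : G t :=
  if insub t is Some s then res G (val s) t (sg_val (f s (a s))) else 0.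
pose R t (b : ext_sheaf B t) (c : G t) :=
  exists a : dprod A, [/\ ext_mem t a, forall s, sg_val b s = i s (a s) & c = v t a].
have vB t a a' : v t (a - a') = v t a - v t a'.
  rewrite /v; case: insub => [s|]; last by rewrite subr0.
  by rewrite -[(a - a') s]/(a s - a' s) raddfB /= raddfB.
have v0 t : v t 0 = 0 by have := vB t 0 0; rewrite !subrr.
have [||||g gR] := @injective_extend _ _ _ injG (ext_sheaf B) R.
- move=> t; exists 0; split=> // s; exact: (esym (raddf0 (i s))).
- move=> t b c b' c' [a [at0 ba ->]] [a' [a't0 ba' ->]]; exists (a - a').
  split; [exact: ext_memB | move=> s | by rewrite vB].
  by rewrite -[(a - a') s]/(a s - a' s) raddfB /= -ba -ba'.
- move=> t c [a [_ ia ->]]; suff -> : a = 0 by [].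
  by apply: dprodP => s; apply: inj_i; rewrite -ia; exact: (esym (raddf0 (i s))).
- move=> t t' b c tt' [a [at0 ba ->]]; exists (ext_res_fun t t' a); split.
  + exact: ext_res_mem.
  + move=> s; rewrite /= /ext_res_fun; case: eqP => _; last by rewrite raddf0.
    by case: insub => [r|]; rewrite ?raddf0 // ba smap_res.
  rewrite /v; case: (insubP _ t) => [s _ sE|tn] /=; last first.
    rewrite raddf0; case: insub => // s.
    rewrite /ext_res_fun insubN // if_same !raddf0 //.
  (* Leaving {t < q} kills both sides: the extension is zero there, and f takes values supported in
     {t < q}. *)
  subst t; have [t'q|t'q] := boolP (t' < q)%O; last first.
    rewrite res_id (sg_memP (f s (a s))) //; case: insubP => // s'.
    by have [_ s'q] := interval_lt s' => _ s'E; rewrite -s'E s'q in t'q.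
  have [s' -> s'E] := interval_insub tt' t'q; subst t'.
  by rewrite /ext_res_fun eqxx valK !res_id -smap_res.
have gS s b : supported (lt q) (g (val s) (@ext_point B s b)).
  move=> t st tq; rewrite smap_res; suff -> : res (ext_sheaf B) (val s) t (ext_point b) = 0.
    by rewrite raddf0.
  apply: sg_inj; apply: dprodP => r; rewrite /= /ext_res_fun; case: eqP => // rE.
  by have [_ rq] := interval_lt r; rewrite inE -rE rq in tq.
pose h s (b : B s) : interval_sheaf s :=
  @sg_elt _ (support G (val s) (lt q)) _ (gS s b).
have hB s : zmod_morphism (h s).
  move=> a b; apply: sg_inj; rewrite sg_valB /= -raddfB; congr (g _ _).
  by apply: sg_inj; apply: dprodP => r; rewrite /= /ext_elt raddfB.
have hres s s' b : res interval_sheaf s s' (h s b) = h s' (res B s s' b).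
  apply: sg_inj; rewrite /= smap_res; congr (g _ _).
  by apply: sg_inj; exact: ext_res_elt.
exists (SheafMap hB hres) => s a; apply: sg_inj; rewrite /=.
apply: gR; exists (ext_elt a); split.
- exact: ext_elt_mem.
- move=> r; rewrite /= /ext_elt; have [<-|ne] := eqVneq s r; first by rewrite !transport_id.
  by rewrite !transport_neq // raddf0.
- by rewrite /v valK res_id /ext_elt transport_id.
Qed.
End IntervalSheaf.

(** * Reduced cohomology of open intervals *)

Lemma resMz d (X : finPOrderType d) (F : sheaf X) x y a k :
  res F x y (a *~ k) = res F x y a *~ k.
Proof. exact: raddfMz. Qed.

Section IntervalComplex.
Context {d} {X : finPOrderType d}.
Variables (p q : X) (I : sheaf_complex X) (c : int).
Hypothesis injI : forall n, injective_sheaf (I n).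
Hypothesis lowI : bounded_below I.
Local Notation Y := (open_interval p q).
Implicit Types (x y t : X) (r s : Y) (n m i j : int).
Local Notation lt q := [pred t | (t < q)%O].
Local Notation le q := [pred t | (t <= q)%O].
Local Notation B y := (shift_complex (supp_complex I y (lt q)) c).

Definition interval_obj n : sheaf Y := interval_sheaf p q (I (n + c)).

Fact interval_diff_res i j s s' (a : interval_obj i s) :
  res (interval_obj j) s s' (cdiff (B (val s)) i j a)
  = cdiff (B (val s')) i j (res (interval_obj i) s s' a).
Proof. by apply: sg_inj; rewrite /= smap_res. Qed.

Definition interval_diff i j : sheaf_map (interval_obj i) (interval_obj j) :=
  @SheafMap _ Y (interval_obj i) (interval_obj j) (fun s => cdiff (B (val s)) i j)
    (fun s => @cdiff_is_zmod_morphism (B (val s)) i j) (@interval_diff_res i j).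

Definition interval_complex : sheaf_complex Y :=
  @SheafComplex _ Y interval_obj interval_diff
    (fun i j s => @cdiff_shape (B (val s)) i j)
    (fun i j k s => @cdiffK (B (val s)) i j k).
Local Notation J := interval_complex.

Lemma interval_bounded_below : bounded_below J.
Proof.
have [a lowIa] := lowI; exists (a - c) => n s nac b; apply: sg_inj.
by apply: lowIa; rewrite -ltrBrDr.
Qed.

Lemma interval_injective n : injective_sheaf (J n).
Proof. exact/injective_interval_sheaf/injI. Qed.

Local Notation Zsheaf := (single_sheaf (const_sheaf int) : sheaf_complex Y).

Variable b : supp_complex I p (lt q) (0 + c).
Hypothesis cb : cyc b.

(** The degree of [b] is written [0 + c] because that is, by conversion, degree 0 of the shifted
    complex. *)
Definition unit_elt s : J 0 s := supp_lt_res I p (val s) q (0 + c) b.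

Lemma res_unit s s' : (s <= s')%O -> res (J 0) s s' (unit_elt s) = unit_elt s'.
Proof.
by move=> ss'; apply: sg_inj; rewrite /= res_comp // ltW //; have [] := interval_lt s.
Qed.

Lemma diff_unit i s : sdiff J 0 i s (unit_elt s) = 0.
Proof.
apply: sg_inj => /=; have /(congr1 (@sg_val _ _)) /= h := cb (i + c).
by rewrite -smap_res h raddf0.
Qed.

Definition unit_coef n s (k : Zsheaf n s) : int :=
  transport (fun n => Zsheaf n s : zmodType) n 0 k.

Definition unit_fun n s (k : Zsheaf n s) : J n s :=
  transport (fun n => J n s : zmodType) 0 n (unit_elt s *~ unit_coef k).

Lemma unit_fun_neq n s (k : Zsheaf n s) : n != 0 -> unit_fun k = 0.
Proof. by move=> ne; rewrite /unit_fun transport_neq // eq_sym. Qed.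

Lemma unit_fun0 s (k : int) : @unit_fun 0 s k = unit_elt s *~ k.
Proof. by rewrite /unit_fun transport_id /unit_coef transport_id. Qed.

Fact unit_is_zmod_morphism n s : zmod_morphism (@unit_fun n s).
Proof.
have [->|ne] := eqVneq n 0; last by move=> k l; rewrite !unit_fun_neq // subr0.
by move=> k l; rewrite !unit_fun0 mulrzBr.
Qed.

Fact unit_res n s s' k : res (J n) s s' (@unit_fun n s k) = @unit_fun n s' (res (Zsheaf n) s s' k).
Proof.
have [n0|ne] := eqVneq n 0; last by rewrite !unit_fun_neq // raddf0.
subst n; rewrite unit_fun0 resMz.
have -> : res (Zsheaf 0) s s' k = (if (s <= s')%O then k else 0 : int) by [].
rewrite unit_fun0; have [ss'|ss'] := boolP (s <= s')%O; first by rewrite res_unit.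
by rewrite res_shape // mul0rz.
Qed.

Fact unit_diff i j s k : sdiff J i j s (@unit_fun i s k) = @unit_fun j s (sdiff Zsheaf i j s k).
Proof.
have -> : unit_fun (sdiff Zsheaf i j s k) = 0 by 
  by have := @unit_is_zmod_morphism j s 0 0; rewrite !subrr.
have [i0|ne] := eqVneq i 0; last by rewrite unit_fun_neq // raddf0.
by subst i; rewrite unit_fun0 smapMz diff_unit mul0rz.
Qed.

Definition unit_map : sheaf_complex_map Zsheaf J :=
  @SheafComplexMap _ Y Zsheaf J
    (fun n => @SheafMap _ Y (Zsheaf n) (J n) (@unit_fun n) (@unit_is_zmod_morphism n)
       (@unit_res n)) unit_diff.

Hypothesis genB : forall y, (p <= y)%O -> (y < q)%O ->
  generates (supp_lt_res I p y q (0 + c) b).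
Hypothesis exB : forall y n, (y < q)%O -> n != 0 -> exact_at (B y) n.

Lemma unit_map_quasi_iso : sheaf_quasi_iso unit_map.
Proof.
move=> s; have [ps sq] := interval_lt s.
apply: (@generator_quasi_iso (stalk_complex Zsheaf s) (stalk_complex J s)
  (stalk_complex_map unit_map s) 0 (1 : int)).
- by move=> w; exists w; rewrite intz.
- by move=> n; exact: single_eq0.
- by move=> n ne; exact: exB.
rewrite (_ : stalk_complex_map unit_map s 0 (1 : int) = unit_elt s); last first.
  exact: (etrans (@unit_fun0 s 1) (mulr1z _)).
by apply/(@shift_generates (supp_complex I (val s) (lt q)) c 0)/genB; rewrite ?(ltW ps).
Qed.

Lemma unit_resolution : injective_resolution unit_map.
Proof.
by split; [exact: interval_bounded_below | exact: interval_injective | exact: unit_map_quasi_iso].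
Qed.

Hypothesis pq : (p < q)%O.

Fact le_lt_sub t : (p <= p)%O -> (p <= t)%O -> le p t -> lt q t.
Proof. by move=> _ _ tp; rewrite inE (le_lt_trans tp). Qed.

Lemma unit_cyc : cyc (b : B p 0).
Proof. exact/shift_cyc. Qed.

Local Notation P := (shift_complex (supp_complex I p (le p)) c).
Local Notation R := (@aug_complex (B p) b unit_cyc).
Local Notation Q := (reduced_complex unit_map).

Definition bottom_fun n (a : P n) : R n :=
  (0, @supp_res d X I p p _ _ le_lt_sub (n + c) a).

Fact bottom_is_zmod_morphism n : zmod_morphism (@bottom_fun n).
Proof. by move=> u v; congr pair; rewrite ?subr0 // raddfB. Qed.

Fact bottom_diff i j (a : P i) : cdiff R i j (bottom_fun a) = bottom_fun (cdiff P i j a).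
Proof.
congr pair; rewrite /= aug_coef0 mulr0z raddf0 add0r.
by apply: sg_inj; rewrite /= smap_res.
Qed.

Definition bottom : complex_map P R :=
  @ComplexMap P R bottom_fun bottom_is_zmod_morphism bottom_diff.

Fact glue_subproof n (a : B p n) :
  ((fun s => supp_lt_res I p (val s) q (n + c) a) : dprod (J n)) \in is_section (F := J n).
Proof.
rewrite unfold_in; apply/asboolP => s s' ss'; apply: sg_inj; rewrite /= res_comp //.
by have [ps _] := interval_lt s; exact: ltW.
Qed.

Definition glue_section n (a : B p n) : sections (J n) := Section_ (glue_subproof a).

Definition glue_fun n (u : R n) : Q n := (u.1, glue_section u.2).

Fact glue_is_zmod_morphism n : zmod_morphism (@glue_fun n).
Proof.
move=> u v; congr pair; apply: sections_eqP => s; apply: sg_inj.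
by rewrite /= raddfB.
Qed.

Lemma glue_transport n m (e : B p n) :
  glue_section (transport (fun n => B p n) n m e) =
  transport (fun n => sections (J n) : zmodType) n m (glue_section e).
Proof.
have [<-|ne] := eqVneq n m; first by rewrite !transport_id.
rewrite !transport_neq //; apply: sections_eqP => s; apply: sg_inj.
by rewrite /= raddf0.
Qed.

Fact glue_diff i j (u : R i) : cdiff Q i j (glue_fun u) = glue_fun (cdiff R i j u).
Proof.
congr pair; rewrite /=.
have -> : augmentation unit_map (transport (single_obj int (-1)) i (-1) u.1) =
    glue_section (b *~ aug_coef u.1 : B p 0).
  apply: sections_eqP => s.
  apply: (etrans (@unit_fun0 s _)); apply: sg_inj.
  by rewrite sg_valMz /= sg_valMz resMz.
rewrite -glue_transport; apply: sections_eqP => s; apply: sg_inj.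
by rewrite /= raddfD /= smap_res.
Qed.

Definition glue : complex_map R Q := @ComplexMap R Q glue_fun glue_is_zmod_morphism glue_diff.

Lemma bottom_inj n : injective (bottom n).
Proof.
move=> u v [] /=; rewrite !res_id => uv; exact: sg_inj.
Qed.

Lemma glue_bottom n a : glue n (bottom n a) = 0.
Proof.
congr pair; apply: sections_eqP => s; apply: sg_inj.
have [ps _] := interval_lt s.
by rewrite /= res_id (sg_memP a) ?ltW // inE lt_geF.
Qed.

Lemma glue_eq0 n u : glue n u = 0 -> exists a, u = bottom n a.
Proof.
case: u => k a ka0; have /= k0 := congr1 fst ka0; subst k.
have a0 s : res (I (n + c)) p (val s) (sg_val a) = 0.
  exact: (congr1 (fun v : Q n => sg_val (section_val v.2 s : sg_type (support _ _ _))) ka0).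
have aS : support (I (n + c)) p (le p) (sg_val a).
  move=> t pt; rewrite inE => tp.
  have [tq|tq] := boolP (t < q)%O; last exact: (sg_memP a).
  have h : (p < t < q)%O by rewrite tq andbT lt_neqAle pt andbT; apply: contra tp => /eqP ->.
  exact: (a0 (exist _ t h)).
by exists (sg_elt aS); congr pair; apply: sg_inj; rewrite /= res_id.
Qed.

(** A section over (p, q) whose values are supported in {t < q} extends by zero to the open set {t >
    p}, and from there to p by flabbiness. *)
Lemma glue_surj n w : exists u, glue n u = w.
Proof.
case: w => k w.
pose v t : I (n + c) t :=
  if (p < t < q)%O =P true is ReflectT h then sg_val (section_val w (exist _ t h)) else 0.
have vE s : v (val s) = sg_val (section_val w s).
  rewrite /v; case: s => t h /=; case: eqP => // h'.
  by rewrite (bool_irrelevance h' h).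
have v0 t : ~~ (t < q)%O -> v t = 0.
  by move=> /negPf tq; rewrite /v; case: eqP => // h; have := h; rewrite tq andbF.
pose W := [set t | (p < t)%O].
have [|a [ares aW]] := @flabby d X (I (n + c)) (@injI (n + c)) W v.
  move=> x y; rewrite !inE => px xy; rewrite (lt_le_trans px xy); split=> //.
  have [xq|xq] := boolP (x < q)%O; last first.
    by rewrite !v0 ?raddf0 //; apply: contra xq; exact: le_lt_trans.
  have hx : (p < x < q)%O by rewrite px.
  have -> : v x = sg_val (section_val w (Sub x hx)) by rewrite -vE.
  have [yq|yq] := boolP (y < q)%O; last first.
    by rewrite v0 //; exact: (sg_memP (section_val w (Sub x hx))).
  have hy : (p < y < q)%O by rewrite (lt_le_trans px xy).
  have -> : v y = sg_val (section_val w (Sub y hy)) by rewrite -vE.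
  have /asboolP wP := sectionP w.
  by rewrite -(wP (Sub x hx) (Sub y hy)).
have aS : support (I (n + c)) p (lt q) (a p).
  move=> t pt tq; rewrite ares // aW ?v0 // inE.
  by rewrite lt_neqAle pt andbT; apply: contraNneq tq => <-.
exists (k, sg_elt aS); congr pair; apply: sections_eqP => s; apply: sg_inj.
have [ps _] := interval_lt s.
by rewrite /= ares ?ltW // aW ?inE // vE.
Qed.

(** The augmentation is added to the middle term as well: [b] generates the only cohomology of
    Gamma_{< q}(I)_p, so R is acyclic. The connecting map from Q to P raises degrees by one, and P
    is shifted by c. *)
Lemma reduced_sphere m : sphere_like (supp_complex I p (le p)) m ->
  sphere_like Q (m - c - 1).
Proof.
move=> sp.
have exR n : exact_at R n.
  apply: aug_exact; first by move=> k k0; exact: exB.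
  apply/(@shift_generates (supp_complex I p (lt q)) c 0).
  have := genB (lexx p) pq.
  by congr generates; apply: sg_inj; rewrite /= res_id.
apply/(connecting_sphere bottom_inj glue_bottom glue_eq0 glue_surj exR (m' := m - c)).
  by rewrite subrK.
exact: shift_sphere.
Qed.
End IntervalComplex.

(** * Codimension functions and chains *)

Lemma chainP d (X : finPOrderType d) (C : {set X}) :
  reflect {in C &, forall x y, (x <= y)%O || (y <= x)%O} (chain C).
Proof.
apply: (iffP forall_inP) => [h x y xC yC|h x xC]; first by have /forall_inP := h x xC; exact.
by apply/forall_inP => y yC; exact: h.
Qed.

Section Codimension.
Context {d} {X : finPOrderType d} (phi : X -> int).
Implicit Types (x y z p : X) (C : {set X}).
Hypothesis covered_phi : forall x y, covered x y -> phi x = phi y + 1.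

Lemma covered_exists x y : (x < y)%O -> exists2 z, covered x z & (z <= y)%O.
Proof.
have [n] := ubnP #|[set p | (x < p < y)%O]|; elim: n y => // n IH y le_n xy.
have [/existsP[p xpy]|/existsPn no] := boolP [exists p, (x < p < y)%O]; last by exists y.
have /andP[xp py] := xpy.
have [|//|z cz zp] := IH p; last by exists z; rewrite ?(le_trans zp) ?ltW.
apply: leq_trans (proper_card _) le_n; apply/properP; split.
  by apply/subsetP => t; rewrite !inE => /andP[-> /lt_trans->].
by exists p; rewrite !inE // ltxx andbF.
Qed.

Lemma codim_lt x y : (x < y)%O -> phi y < phi x.
Proof.
have [n] := ubnP #|[set p | (x < p <= y)%O]|; elim: n x => // n IH x le_n xy.
have [z cz zy] := covered_exists xy; have [xz _] := cz; rewrite (covered_phi cz).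
have [->|ne] := eqVneq z y; first by rewrite ltrDl.
apply: lt_trans (_ : phi z < _); last by rewrite ltrDl.
apply: IH; last by rewrite lt_neqAle ne.
apply: leq_trans (proper_card _) le_n; apply/properP; split.
  by apply/subsetP => t; rewrite !inE => /andP[/(lt_trans xz)-> ->].
by exists z; rewrite !inE ?xz // ltxx.
Qed.

Lemma codim_le x y : (x <= y)%O -> phi y <= phi x.
Proof. by rewrite le_eqVlt => /predU1P[->//|/codim_lt/ltW]. Qed.

(** Being strictly decreasing, phi embeds a chain of [x, y] into the integers from phi y to phi
    x. *)
Lemma chain_card_le C x y : (x <= y)%O -> chain C -> C \subset closed_interval x y ->
  #|C|%:Z <= phi x - phi y + 1.
Proof.
move=> xy /chainP hC /subsetP sC.
pose N := `|(phi x - phi y)%R|%N.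
have NE : phi x - phi y = N%:Z by rewrite gez0_abs // subr_ge0 codim_le.
pose f z : 'I_N.+1 := inord `|(phi x - phi z)%R|%N.
have fE z : z \in C -> (f z : nat)%:Z = phi x - phi z.
  move=> /sC; rewrite inE => /andP[/codim_le xz /codim_le zy].
  by rewrite /f inordK; lia.
have inj_f : {in C &, injective f}.
  move=> u v uC vC /(congr1 (fun i : 'I_N.+1 => (i : nat)%:Z)); rewrite !fE // => uv.
  have {}uv : phi u = phi v by lia.
  have [//|ne] := eqVneq u v.
  case/orP: (hC u v uC vC); rewrite le_eqVlt ?(negPf ne) 1?eq_sym ?(negPf ne);
    by move=> /codim_lt; rewrite uv ltxx.
rewrite NE -(card_in_imset inj_f).
have : (#|f @: C| <= N.+1)%N by apply: leq_trans (max_card _) _; rewrite card_ord.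
lia.
Qed.

(** By maximality the successor of c in C covers c in X, so phi drops by exactly 1 at each step and
    takes every value from phi x to phi y on C. *)
Lemma maximal_chain_card C x y : (x <= y)%O -> maximal_chain (closed_interval x y) C ->
  #|C|%:Z = phi x - phi y + 1.
Proof.
move=> xy /maxsetP[/andP[sC chC] maxC].
apply/eqP; rewrite eq_le chain_card_le //=.
have hC := chainP _ chC; have sCi := subsetP sC.
have add p : p \in closed_interval x y -> {in C, forall v, (v <= p)%O || (p <= v)%O} -> p \in C.
  move=> pI pC; rewrite -(maxC (p |: C)) ?setU11 ?subsetU1 //.
  rewrite subUset sub1set pI sC /=; apply/chainP => u v.
  rewrite !inE => /predU1P[->|uC] /predU1P[->|vC]; rewrite ?lexx //.
  - by rewrite orbC; exact: pC.
  - exact: pC.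
  - exact: hC.
have xC : x \in C.
  by apply: add; rewrite ?inE ?lexx // => v /sCi; rewrite inE => /andP[-> _]; rewrite orbT.
have yC : y \in C.
  by apply: add; rewrite ?inE ?lexx ?xy // => v /sCi; rewrite inE => /andP[_ ->].
have next c : c \in C -> phi y < phi c -> exists2 w, w \in C & phi w = phi c - 1.
  move=> cC yc; have cy : (c < y)%O.
    have := sCi c cC; rewrite inE => /andP[_]; rewrite le_eqVlt => /predU1P[cE|//].
    by rewrite cE ltxx in yc.
  have yS : (y \in C) && (c < y)%O by rewrite yC.
  (* The successor of c in C is the element above c with the largest phi, as phi decreases along the
     chain. *)
  have [w /andP[wC cw] wmax] := @arg_maxP _ _ _ y (fun w => (w \in C) && (c < w)%O) phi yS.
  exists w => //; suff : phi c = phi w + 1 by move=> ->; rewrite addrK.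
  apply: covered_phi; split=> // p; apply/negP => /andP[cp pw].
  have after v : v \in C -> (c < v)%O -> (w <= v)%O.
    move=> vC cv; have := wmax v; rewrite vC cv => /(_ isT) /= vw.
    case/orP: (hC v w vC wC) => //; rewrite le_eqVlt => /predU1P[->//|/codim_lt].
    by rewrite ltNge vw.
  have /andP[xc _] : (x <= c <= y)%O by have := sCi c cC; rewrite inE.
  have /andP[_ wy] : (x <= w <= y)%O by have := sCi w wC; rewrite inE.
  have pC : p \in C.
    apply: add => [|v vC].
      by rewrite inE (le_trans xc (ltW cp)) (le_trans (ltW pw) wy).
    have [cv|ncv] := boolP (c < v)%O; first by rewrite (le_trans (ltW pw)) ?orbT ?after.
    have /orP[|] := hC v c vC cC; first by move=> vc; rewrite (le_trans vc (ltW cp)).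
    by rewrite le_eqVlt (negPf ncv) orbF => /eqP <-; rewrite (ltW cp).
  by have := after p pC cp; rewrite (lt_geF pw).
pose N := `|(phi x - phi y)%R|%N.
have NE : phi x - phi y = N%:Z by rewrite gez0_abs // subr_ge0 codim_le.
have all_k k : (k <= N)%N -> exists2 c, c \in C & phi c = phi x - k%:Z.
  elim: k => [|k IH] kN; first by exists x; rewrite ?subr0.
  have [c cC cE] := IH (ltnW kN).
  have [|w wC wE] := next c cC; first by lia.
  by exists w => //; lia.
have ex_c (k : 'I_N.+1) : exists c, (c \in C) && (phi c == phi x - (k : nat)%:Z).
  by have [c cC /eqP cE] := all_k k (leq_ord k); exists c; rewrite cC.
pose g k := xchoose (ex_c k).
have gP k : (g k \in C) && (phi (g k) == phi x - (k : nat)%:Z) := xchooseP (ex_c k).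
have inj_g : injective g.
  move=> k l gkl; apply: val_inj; apply/eqP; rewrite -eqz_nat /=.
  have /andP[_ /eqP hk] := gP k; have /andP[_ /eqP hl] := gP l.
  by apply/eqP; move: hk; rewrite gkl hl; lia.
rewrite NE; have := card_imset 'I_N.+1 inj_g; rewrite cardT size_enum_ord => cg.
have : (#|g @: 'I_N.+1| <= #|C|)%N.
  by apply/subset_leq_card/subsetP => _ /imsetP[k _ ->]; have /andP[] := gP k.
by rewrite cg -[1]/(1%N%:Z) -PoszD lez_nat addn1.
Qed.

Lemma codim_catenary : catenary X.
Proof.
move=> x y xy C C' /(maximal_chain_card xy) h /(maximal_chain_card xy) h'.
by apply/eqP; rewrite -eqz_nat h h'.
Qed.

(** Adding x and y to a chain of the open interval gives a chain of [x, y], and removing them from a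
    maximal one goes back: phi x - phi y + 1 elements, less 2 for the endpoints, less 1 from
    cardinality to length. *)
Lemma dimension_interval x y : (x < y)%O ->
  dimension (open_interval x y) = phi x - phi y - 2.
Proof.
move=> xy; have xley := ltW xy; rewrite /dimension.
have valP' (s : open_interval x y) : (x < val s)%O && (val s < y)%O := valP s.
have [D maxD _] : {D | maximal_chain (closed_interval x y) D & set0 \subset D}.
  by apply: maxset_exists; rewrite sub0set; apply/chainP => u; rewrite inE.
have cD := maximal_chain_card xley maxD.
have /maxsetP[/andP[/subsetP sD /chainP chD] _] := maxD.
set M := \max_(C | _) _; suff : M%:Z = phi x - phi y - 1 by lia.
apply/eqP; rewrite eq_le; apply/andP; split.
  suff le_M : forall C : {set open_interval x y}, chain C -> (#|C|.+1 <= `|phi x - phi y|)%N.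
    have : (M <= `|(phi x - phi y)%R|.-1)%N.
      by apply/bigmax_leqP => C /le_M; case: `|_|%N.
    by have := codim_lt xy; lia.
  move=> C /chainP chC.
  have := @chain_card_le (x |: (y |: val @: C)) x y xley.
  have ny : y \notin val @: C.
    apply/imsetP => -[s _ sE]; by have /andP[_] := valP' s; rewrite /= -sE ltxx.
  have nx : x \notin y |: val @: C.
    rewrite inE negb_or inE (lt_eqF xy) /=; apply/imsetP => -[s _ sE].
    by have /andP[] := valP' s; rewrite /= -sE ltxx.
  rewrite !cardsU1 ny nx card_imset; last exact: val_inj.
  have sub : x |: (y |: val @: C) \subset closed_interval x y.
    rewrite !subUset !sub1set !inE !lexx xley /=; apply/subsetP => _ /imsetP[s _ ->].
    by have /andP[/ltW xs /ltW sy] := valP' s; rewrite inE xs.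
  have I_C z : z \in x |: (y |: val @: C) -> (x <= z <= y)%O.
    by move/(subsetP sub); rewrite inE.
  have ch : chain (x |: (y |: val @: C)).
    apply/chainP => u v hu hv; have /andP[xu uy] := I_C u hu; have /andP[xv vy] := I_C v hv.
    move: hu hv; rewrite !inE => /or3P[/eqP->|/eqP->|/imsetP[s sC ->]]; rewrite ?xv ?vy ?orbT //.
    move=> /or3P[/eqP->|/eqP->|/imsetP[s' s'C ->]].
    - by have /andP[/ltW -> _] := valP' s; rewrite orbT.
    - by have /andP[_ /ltW ->] := valP' s.
    - exact: chC.
  by move=> /(_ ch sub); have := codim_lt xy; rewrite /= !add1n; move: #|C| => k; lia.
pose C : {set open_interval x y} := [set s | val s \in D].
have chC : chain C by apply/chainP => s s'; rewrite !inE => sD' s'D; exact: chD.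
have CM : (#|C| <= M)%N by exact: leq_bigmax_cond.
suff : (#|D| <= #|C|.+2)%N by lia.
have sub : D \subset x |: (y |: val @: C).
  apply/subsetP => z zD; have := sD z zD; rewrite !inE !le_eqVlt => /andP[].
  move=> /predU1P[<-|xz]; first by rewrite eqxx.
  move=> /predU1P[->|zy]; first by rewrite eqxx orbT.
  have h : (x < z < y)%O by rewrite xz.
  apply/or3P/Or33/imsetP; exists (Sub z h); rewrite ?SubK //.
  by rewrite inE SubK.
apply: leq_trans (subset_leq_card sub) _.
rewrite !cardsU1 card_imset; last exact: val_inj.
by apply: (@leq_add _ _ 1); rewrite ?leq_b1 //; apply: (@leq_add _ _ 1); rewrite ?leq_b1.
Qed.
End Codimension.

Theorem theorem4p15 (d : Order.disp_t) (X : finPOrderType d)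
    (Omega : sheaf_complex X) (phi : X -> int)
    (hOmega : canonical_complex Omega)
    (hphi : codimension_function Omega phi) :
  ((forall x y : X, covered x y -> phi x = phi y + 1) /\ catenary X) /\
  (forall x y : X, (x < y)%O -> homological_sphere (open_interval x y)).
Proof.
have [_ _ [I [s [hs bidual]]]] := hOmega; have [lowI injI _] := hs.
have sphere x := codimension_sphere x hs hphi.
have exact_lt x y n (xy : (x < y)%O) := bidual_exact lowI injI bidual (n := n) xy (sphere y).
have cov x y := covered_codim injI sphere exact_lt (p := x) (q := y).
split; first by split; [exact: cov | exact: codim_catenary cov].
(* The degree in which Gamma_{< y}(I) has its cohomology; shifting by it turns the interval complex
   into a resolution of Z. *)
move=> x y xy; pose c := phi y + 1.
have cE : 0 + c = phi y + 1 by rewrite add0r.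
have [b gb] := generator_lt injI sphere exact_lt xy cE.
have cb : cyc b.
  have [cb _ _] := gb x (lexx x) xy.
  (* [gb] concerns restrictions of [b], and the restriction from x to itself is [b]. *)
  have -> : b = supp_lt_res I x x y (0 + c) b by apply: sg_inj; rewrite /= res_id.
  exact: cb.
have exB z n : (z < y)%O -> n != 0 ->
    exact_at (shift_complex (supp_complex I z [pred t | (t < y)%O]) c) n.
  move=> zy n0; apply/shift_exact; have [ex _] := sphere_lt injI sphere exact_lt zy erefl.
  by apply: ex; apply: contra n0; rewrite -/c -{2}[c]add0r => /eqP/addIr ->.
exists (interval_complex x y I c), (unit_map cb); split; first exact: unit_resolution.
have [exQ genQ] := reduced_sphere injI cb gb exB xy (sphere x).
have dimE : dimension (open_interval x y) = phi x - c - 1.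
  by rewrite (dimension_interval cov xy) /c; lia.
rewrite dimE => i; have [->|ne] := eqVneq i (phi x - c - 1).
  exact: generates_cohomology.
by apply/exact_cohomology; exact: exQ.
Qed.
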